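(* Let $f:\mathbb{R}^n\to\mathbb{R}$, $g:\mathbb{R}^n\to\mathbb{R}^m$, $h:\mathbb{R}^n\to\mathbb{R}^p$, $\Phi_i:\mathbb{R}^n\to\mathbb{R}^q$ ($i=1,\dots,l$) be continuously differentiable, let $S=\bigcup_{r=1}^R S_r\subseteq\mathbb{R}^q$ with each $S_r$ a linear subspace, and consider the problem (MPDSC) $$\min_x f(x)\quad\text{s.t.}\quad g(x)\le0,\ h(x)=0,\ \Phi_i(x)\in S,\ i=1,\dots,l.$$ Let $x^*$ be a local optimal solution of (MPDSC) and $d\in\mathcal{C}(x^* )$. (i) If MSCQ in direction $d$ holds at $x^*$, then $x^*$ is M-stationary $(d)$. Moreover, if all functions are twice continuously differentiable, then there exists an M-stationary $(d)$ multiplier $(\lambda^g,\lambda^h,\lambda^\Phi)$ such that $$d^T\nabla_x^2\mathcal{L}(x^*,\lambda^g,\lambda^h,\lambda^\Phi)d\ge0.$$ (ii) If MPDSC-LICQ $(d)$ holds at $x^*$, then $x^*$ is S-stationary $(d)$. Moreover, if all functions are twice continuously differentiable, then there exists an S-stationary $(d)$ multiplier $(\lambda^g,\lambda^h,\lambda^\Phi)$ such that $d^T\nabla_x^2\mathcal{L}(x^*,\lambda^g,\lambda^h,\lambda^\Phi)d\ge0$. Conversely, let $x^*$ be a feasible solution of (MPDSC). Suppose that all functions are twice continuously differentiable and that for every $0\ne d\in\mathcal{C}(x^* )$ there exists an S-stationary $(d)$ multiplier $(\lambda^g,\lambda^h,\lambda^\Phi)$ such that $d^T\nabla_x^2\mathcal{L}(x^*,\lambda^g,\lambda^h,\lambda^\Phi)d>0$.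 Then $x^*$ is a strict local minimizer of (MPDSC).
   Context: Notation. $\mathcal{F}$ is the feasible set of (MPDSC); $d_\Omega$ is the distance function to $\Omega$; $\mathbb{B}$ is the open unit ball. $\mathcal{I}_g(x^* )=\{i : g_i(x^* )=0\}$. For $y\in S$, $I(y)=\{r : y\in S_r\}$. $\nabla g_i(x^* )d$, $\nabla\Phi_i(x^* )d$, etc. denote derivatives applied to $d$. Critical cone: $\mathcal{C}(x^* )$ is the set of $d\in\mathbb{R}^n$ with $\nabla g_i(x^* )d\le0$ for $i\in\mathcal{I}_g(x^* )$, $\nabla h_i(x^* )d=0$ for $i=1,\dots,p$, $\nabla\Phi_i(x^* )d\in\bigcup_{r\in I(\Phi_i(x^* ))}S_r$ for $i=1,\dots,l$, and $\nabla f(x^* )d\le0$. For $d\in\mathcal{C}(x^* )$, $\mathcal{I}_g^*(d)=\{i\in\mathcal{I}_g(x^* ) : \nabla g_i(x^* )d=0\}$. Directional normal cone: for closed $\Omega$, $y\in\Omega$ and a direction $w$, $N_\Omega(y;w)$ is the set of $v$ for which there exist $t_k\downarrow0$, $w^k\to w$, $v^k\to v$ with $v^k\in\hat N_\Omega(y+t_kw^k)$, where $\hat N_\Omega$ is the Fréchet (regular) normal cone. $T_\Omega$ is the Bouligand tangent cone. Stationarity: $x^*$ feasible is S-stationary $(d)$, resp. M-stationary $(d)$, for $d\in\mathcal{C}(x^* )$, if there is $(\lambda^g,\lambda^h,\lambda^\Phi)\in\mathbb{R}^m\times\mathbb{R}^p\times\prod_{i=1}^l\mathbb{R}^q$ with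 $\lambda^g_i\ge0$ for $i\in\mathcal{I}^*_g(d)$, $\lambda^g_i=0$ for $i\notin\mathcal{I}^*_g(d)$, $$\nabla f(x^* )+\sum_{i\in\mathcal{I}_g^*(d)}\lambda^g_i\nabla g_i(x^* )+\sum_{i=1}^p\lambda_i^h\nabla h_i(x^* )+\sum_{i=1}^l\nabla\Phi_i(x^* )^T\lambda_i^\Phi=0,$$ and, for all $i=1,\dots,l$, $\lambda_i^\Phi\in\hat N_{T_S(\Phi_i(x^* ))}(\nabla\Phi_i(x^* )d)=\bigcap_{r\in I(\Phi_i(x^* ))\cap I(\nabla\Phi_i(x^* )d)}S_r^\perp$ (S-stationarity), resp. $\lambda_i^\Phi\in N_S(\Phi_i(x^* );\nabla\Phi_i(x^* )d)$ (M-stationarity). Such a $(\lambda^g,\lambda^h,\lambda^\Phi)$ is called an S-stationary $(d)$, resp. M-stationary $(d)$, multiplier. MSCQ in direction $d$ at $x^*$: there exist $\alpha\ge0$, $\rho>0$, $\delta>0$ such that $d_{\mathcal{F}}(x)\le\alpha\bigl(\sum_{i=1}^m\max\{g_i(x),0\}+\sum_{i=1}^p|h_i(x)|+\sum_{i=1}^ld_S(\Phi_i(x))\bigr)$ for all $x\in x^*+V_{\rho,\delta}(d)$, where $V_{\rho,\delta}(d)=\{z\in\rho\mathbb{B} : \big\|\|d\|z-\|z\|d\big\|\le\delta\|z\|\|d\|\}$. MPDSC-LICQ $(d)$ at $x^*$: there is no nonzero $(\lambda^g,\lambda^h,\lambda^\Phi)\in\mathbb{R}^m\times\mathbb{R}^p\times\prod_{i=1}^l\mathbb{R}^q$,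 with $\lambda^g_i=0$ for $i\notin\mathcal{I}_g^*(d)$ (no sign condition on $\lambda^g$) and $\lambda_i^\Phi\in\sum_{r\in I(\Phi_i(x^* ))\cap I(\nabla\Phi_i(x^* )d)}S_r^\perp$ (sum of subspaces), such that $\sum_{i\in\mathcal{I}_g^*(d)}\lambda^g_i\nabla g_i(x^* )+\sum_{i=1}^p\lambda_i^h\nabla h_i(x^* )+\sum_{i=1}^l\nabla\Phi_i(x^* )^T\lambda_i^\Phi=0$. Lagrangian: $\mathcal{L}(x,\lambda^g,\lambda^h,\lambda^\Phi)=f(x)+\langle\lambda^g,g(x)\rangle+\langle\lambda^h,h(x)\rangle+\sum_{i=1}^l\langle\lambda_i^\Phi,\Phi_i(x)\rangle$. *)

(* Defs.v *)
From mathcomp Require Import all_boot all_order all_algebra.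
From mathcomp Require Import all_classical all_reals all_analysis.
Set Implicit Arguments.
Unset Strict Implicit.
Unset Printing Implicit Defensive.
Import Order.TTheory GRing.Theory Num.Theory.
Import numFieldNormedType.Exports.
Local Open Scope classical_set_scope.
Local Open Scope ring_scope.

Section Euclidean.
Context {R : realType} {k : nat}.
Implicit Types (u v y w : 'rV[R]_k) (Omega : set 'rV[R]_k).

Definition dotp u v : R := \sum_i u 0 i * v 0 i.

(* Euclidean norm; the library norm on row vectors is the sup norm. *)
Definition enorm u : R := Num.sqrt (dotp u u).

Definition dist Omega y : R := inf [set enorm (y - z) | z in Omega].

(* Both normal cones are empty at points outside of the set. *)
Definition frechet_normal Omega y : set 'rV[R]_k :=
  [set v | Omega y /\ forall e : R, 0 < e ->
    \forall z \near within Omega (nbhs y), dotp v (z - y) <= e * enorm (z - y)].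

Definition dir_normal Omega y w : set 'rV[R]_k :=
  [set v | Omega y /\
    exists (t_ : nat -> R) (w_ v_ : nat -> 'rV[R]_k),
    [/\ (forall j, 0 < t_ j), t_ @ \oo --> (0 : R), w_ @ \oo --> w,
        v_ @ \oo --> v
      & forall j, frechet_normal Omega (y + t_ j *: w_ j) (v_ j)]].

Definition tangent_cone Omega y : set 'rV[R]_k :=
  [set w | exists (t_ : nat -> R) (w_ : nat -> 'rV[R]_k),
    [/\ (forall j, 0 < t_ j), t_ @ \oo --> (0 : R), w_ @ \oo --> w
      & forall j, Omega (y + t_ j *: w_ j)]].

Definition dir_nbhd (rho delta : R) w : set 'rV[R]_k :=
  [set z | enorm z < rho /\
    enorm (enorm w *: z - enorm z *: w) <= delta * enorm z * enorm w].

Definition orth (U : {vspace 'rV[R]_k}) : set 'rV[R]_k :=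
  [set v | forall u, u \in U -> dotp v u = 0].

End Euclidean.

Section Smoothness.
Context {R : realType} {n : nat}.

(* In finite dimension, continuity of x |-> 'd F x for the operator norm is
   continuity of x |-> 'd F x v for every v. *)
Definition C1 (V : normedModType R) (F : 'rV[R]_n -> V) : Prop :=
  (forall x, differentiable F x) /\
  (forall v, continuous (fun x => 'd F x v)).

Definition C2 (V : normedModType R) (F : 'rV[R]_n -> V) : Prop :=
  C1 F /\ forall v, C1 (fun x => 'd F x v : V).

Definition grad (F : 'rV[R]_n -> R) (x : 'rV[R]_n) : 'rV[R]_n :=
  \row_j 'D_('e_j) F x.

Definition hessian (F : 'rV[R]_n -> R) (x : 'rV[R]_n) : 'M[R]_n :=
  \matrix_(i, j) 'D_('e_i) ('D_('e_j) F) x.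

End Smoothness.

(* The problem  min f(x)  s.t.  g(x) <= 0, h(x) = 0, Phi_i(x) \in \bigcup_r S_r. *)
Record mpdsc (R : realType) (n m p l q N : nat) := MPDSC {
  obj : 'rV[R]_n -> R;
  ineq : 'rV[R]_n -> 'rV[R]_m;
  eqc : 'rV[R]_n -> 'rV[R]_p;
  Phi : 'I_l -> 'rV[R]_n -> 'rV[R]_q;
  subsp : 'I_N -> {vspace 'rV[R]_q} }.

Section Problem.
Context {R : realType} {n m p l q N : nat}.
Variable P : mpdsc R n m p l q N.
Local Notation f := (obj P).
Local Notation g := (ineq P).
Local Notation h := (eqc P).
Local Notation Phi := (Phi P).
Local Notation S_ := (subsp P).
Implicit Types (x d : 'rV[R]_n) (y z : 'rV[R]_q).
Implicit Types (lg : 'rV[R]_m) (lh : 'rV[R]_p) (lPhi : 'I_l -> 'rV[R]_q).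

Definition smooth1 : Prop :=
  [/\ C1 f, C1 g, C1 h & forall i, C1 (Phi i)].

Definition smooth2 : Prop :=
  [/\ C2 f, C2 g, C2 h & forall i, C2 (Phi i)].

Definition Sset : set 'rV[R]_q := [set y | exists r, y \in S_ r].

Definition feasible : set 'rV[R]_n :=
  [set x | [/\ forall i, g x 0 i <= 0, h x = 0 & forall i, Sset (Phi i x)]].

Definition local_min x : Prop :=
  feasible x /\ \forall x' \near x, feasible x' -> f x <= f x'.

Definition strict_local_min x : Prop :=
  feasible x /\ \forall x' \near x, feasible x' -> x' != x -> f x < f x'.

Definition critical_cone x : set 'rV[R]_n :=
  [set d | [/\ forall i, g x 0 i = 0 -> ('d g x d) 0 i <= 0,
               'd h x d = 0,
               forall i, exists2 r, Phi i x \in S_ r & 'd (Phi i) x d \in S_ r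
             & 'd f x d <= 0]].

Definition active x d : pred 'I_m :=
  [pred i | (g x 0 i == 0) && (('d g x d) 0 i == 0)].

Definition MSCQ x d : Prop :=
  exists alpha rho delta : R, [/\ 0 <= alpha, 0 < rho, 0 < delta &
    forall z : 'rV[R]_n, dir_nbhd rho delta d z ->
      dist feasible (x + z) <=
        alpha * (\sum_i Num.max (g (x + z) 0 i) 0 + \sum_i `|h (x + z) 0 i|
                 + \sum_i dist Sset (Phi i (x + z)))].

(* 'J acts on row vectors from the right, so it is the transpose of the usual
   Jacobian, and lPhi i *m ('J (Phi i) x)^T is the vector
   (nabla Phi_i(x))^T lPhi_i written as a row. *)
Definition constraint_grad x d lg lh lPhi : 'rV[R]_n :=
  \sum_(i | active x d i) lg 0 i *: grad (fun x' => g x' 0 i) x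
  + \sum_i lh 0 i *: grad (fun x' => h x' 0 i) x
  + \sum_i lPhi i *m ('J (Phi i) x)^T.

Definition multiplier x d lg lh lPhi : Prop :=
  [/\ forall i, active x d i -> 0 <= lg 0 i,
      forall i, ~~ active x d i -> lg 0 i = 0
    & grad f x + constraint_grad x d lg lh lPhi = 0].

Definition S_multiplier x d lg lh lPhi : Prop :=
  multiplier x d lg lh lPhi /\
  forall i, frechet_normal (tangent_cone Sset (Phi i x))
                           ('d (Phi i) x d) (lPhi i).

Definition M_multiplier x d lg lh lPhi : Prop :=
  multiplier x d lg lh lPhi /\
  forall i, dir_normal Sset (Phi i x) ('d (Phi i) x d) (lPhi i).

Definition S_stationary x d : Prop :=
  exists lg lh lPhi, S_multiplier x d lg lh lPhi.

Definition M_stationary x d : Prop :=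
  exists lg lh lPhi, M_multiplier x d lg lh lPhi.

(* The sum of the subspaces (S_ r)^\perp over the r with y, z \in S_ r. *)
Definition sum_orth y z : set 'rV[R]_q :=
  [set v | exists2 mu : 'I_N -> 'rV[R]_q,
     forall r, y \in S_ r -> z \in S_ r -> orth (S_ r) (mu r)
   & v = \sum_(r | (y \in S_ r) && (z \in S_ r)) mu r].

Definition MPDSC_LICQ x d : Prop :=
  forall lg lh lPhi,
    (forall i, ~~ active x d i -> lg 0 i = 0) ->
    (forall i, sum_orth (Phi i x) ('d (Phi i) x d) (lPhi i)) ->
    constraint_grad x d lg lh lPhi = 0 ->
    [/\ lg = 0, lh = 0 & forall i, lPhi i = 0].

Definition lagrangian lg lh lPhi x : R :=
  f x + dotp lg (g x) + dotp lh (h x) + \sum_i dotp (lPhi i) (Phi i x).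

Definition lagrangian_curv x d lg lh lPhi : R :=
  (d *m hessian (lagrangian lg lh lPhi) x *m d^T) 0 0.

End Problem.

(* Main.v *)
Require Import Defs.
From HB Require Import structures.
From mathcomp Require Import all_boot all_order all_algebra.
From mathcomp Require Import all_classical all_reals all_analysis.
From mathcomp Require Import ring lra.
Set Implicit Arguments.
Unset Strict Implicit.
Unset Printing Implicit Defensive.
Import Order.TTheory GRing.Theory Num.Theory.
Import numFieldNormedType.Exports.
Local Open Scope classical_set_scope.
Local Open Scope ring_scope.

(** Why the theorem holds.  Fix, for every [i], one index [r i] such that the
    subspace [S_ (r i)] contains both [Phi i x] and ['d (Phi i) x d].  Requiring
    [Phi i] to stay in [S_ (r i)] turns the problem into an ordinary nonlinear
    program, whose constraints are the inequalities active along [d], the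
    equations [h], and the linear equations of [S_ (r i)] composed with [Phi i];
    all of them vanish at [x] and have zero derivative along [d].

    Suppose that [x] also minimizes an exact penalty function of this program on a
    cone around [d].  Evaluating the penalty function at [x + t (d + e w)], or for
    twice differentiable data at [x + t d + (t ^ 2 / 2) w], and letting [t] tend
    to [0] yields an inequality, valid for all [w], between an affine function of
    [w] and a sum of positive parts and absolute values of affine functions of
    [w].  The terms of this sum can be replaced by multipliers one after the other
    ([sum_pen_multiplier]).  What remains is an affine function of [w] bounded
    below: its linear part, the gradient of the Lagrangian, vanishes, and its
    constant part, the curvature of the Lagrangian along [d], is nonnegative
    ([penalized_multiplier], [penalized_choice]).  The multiplier obtained for
    [Phi i] is orthogonal to [S_ (r i)].

    The two constraint qualifications provide the penalty function.  Metric
    subregularity for the union gives it for each choice of subspaces, because the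
    distance to the union is at most the distance to one of the subspaces
    ([mscq_penalized]).  Under linear independence, the constraints of the program
    have independent gradients, and minimizing the residual over small balls
    proves metric regularity ([metric_regularity], [licq_penalized]).

    - (i) Choose [S_ (r i)] maximal for inclusion ([maximal_choice]).  Near a
      generic point of [S_ (r i)] the union coincides with [S_ (r i)], and generic
      points are dense in it; so the orthogonal complement of [S_ (r i)] consists
      of directional limiting normals ([orth_sub_dir_normal]).

    - (ii) Linear independence makes the multiplier the same for all choices, so
      it is orthogonal to all the relevant subspaces simultaneously, which is the
      Frechet normality to the tangent cone ([tangent_normalP],
      [licq_S_multiplier]).

    - Converse.  If [x] is not a strict local minimizer, feasible points at which
      [f] does not exceed [f x] accumulate at [x], and compactness of the unit
      sphere provides a limit direction [d], which is critical.  At these points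
      the Lagrangian of an S-multiplier along [d] does not exceed its value at
      [x], while by Taylor's formula its positive curvature makes it larger
      ([sufficient_condition]). *)

(** * Multipliers of a piecewise linear penalty *)

Section PenaltyMultiplier.
Context {R : realType} {V : lmodType R}.
Implicit Types (phi s : V -> R) (k : R).

Definition convex_fct phi : Prop := forall x y t, 0 <= t <= 1 ->
  phi (t *: x + (1 - t) *: y) <= t * phi x + (1 - t) * phi y.

Definition affine_fct s : Prop := forall x y t,
  s (t *: x + (1 - t) *: y) = t * s x + (1 - t) * s y.

Definition pen (eqn : bool) (u : R) : R := if eqn then `|u| else Num.max u 0.

Lemma pen_ge0 eqn u : 0 <= pen eqn u.
Proof. by rewrite /pen; case: eqn; rewrite ?normr_ge0// le_max lexx orbT. Qed.

Lemma pen0 eqn : pen eqn 0 = 0.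
Proof. by rewrite /pen; case: eqn; rewrite ?normr0// maxxx. Qed.

Lemma penM eqn t u : 0 <= t -> pen eqn (t * u) = t * pen eqn u.
Proof.
move=> t0; rewrite /pen; case: eqn; first by rewrite normrM ger0_norm.
by rewrite -{1}(mulr0 t) maxr_pMr.
Qed.

Lemma convexD phi psi : convex_fct phi -> convex_fct psi ->
  convex_fct (fun w => phi w + psi w).
Proof.
move=> cp cq x y t t01; have := cp x y t t01; have := cq x y t t01.
by move=> h1 h2; rewrite !mulrDr; lra.
Qed.

Lemma affine_convex s : affine_fct s -> convex_fct s.
Proof. by move=> As x y t _; rewrite As. Qed.

Lemma affineZ k s : affine_fct s -> affine_fct (fun w => k * s w).
Proof. by move=> As x y t; rewrite As; ring. Qed.

Lemma convex_pen k eqn s : 0 <= k -> affine_fct s ->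
  convex_fct (fun w => k * pen eqn (s w)).
Proof.
move=> k0 As x y t /andP[t0 t1]; rewrite As !(mulrCA _ k) -mulrDr.
apply: ler_wpM2l => //; have t1' : 0 <= 1 - t by rewrite subr_ge0.
rewrite /pen; case: eqn.
  rewrite (le_trans (ler_normD _ _))// !normrM (ger0_norm t0).
  by rewrite (ger0_norm t1').
rewrite ge_max; apply/andP; split.
  by apply: lerD; apply: ler_wpM2l => //; rewrite le_max lexx.
by apply: addr_ge0; apply: mulr_ge0 => //; rewrite le_max lexx orbT.
Qed.

(** The slopes [- phi w / s w] forced from the side [s w > 0] lie below the
    slopes allowed from the side [s w < 0]: the segment joining a point of
    either side crosses [s = 0], where convexity bounds a positive combination
    of the two values of [phi] below by [0].  Any number between the two
    families is a multiplier, and their supremum is one. *)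
Lemma pos_part_multiplier phi s k : convex_fct phi -> affine_fct s ->
  (forall w, 0 <= phi w + k * Num.max (s w) 0) ->
  exists2 lam, 0 <= lam & forall w, 0 <= phi w + lam * s w.
Proof.
move=> cphi As pos.
pose E := [set lam : R | lam = 0 \/ exists2 w, 0 < s w & lam = - phi w / s w].
have E0 : E 0 by left.
have below w : s w <= 0 -> 0 <= phi w.
  by move=> sw; have := pos w; rewrite (max_idPr sw) mulr0 addr0.
have slope u w : s w < 0 -> E u -> u <= phi w / - s w.
  move=> sw [->|[z sz ->]].
    by apply: divr_ge0; rewrite ?below ?ltW// oppr_gt0.
  rewrite ler_pdivlMr ?oppr_gt0// mulrAC ler_pdivrMr//.
  have D0 : 0 < s z - s w by lra.
  pose t := - s w / (s z - s w).
  have t01 : 0 <= t <= 1.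
    by rewrite /t ler_pdivrMr// mul1r; apply/andP; split; [apply: divr_ge0|]; lra.
  have sE : s (t *: z + (1 - t) *: w) = 0.
    by rewrite As /t; field; rewrite gt_eqF.
  have := cphi z w t t01; have := below (t *: z + (1 - t) *: w).
  rewrite sE lexx => /(_ isT) h1 h2; have := le_trans h1 h2.
  have -> : t * phi z + (1 - t) * phi w =
            (- s w * phi z + s z * phi w) / (s z - s w).
    by rewrite /t; field; rewrite gt_eqF.
  by rewrite pmulr_lge0 ?invr_gt0//; lra.
have ubE : has_ubound E.
  exists (Num.max k 0) => u [->|[w sw ->]]; first by rewrite le_max lexx orbT.
  rewrite le_max ler_pdivrMr//; have := pos w.
  by rewrite (max_idPl (ltW sw)) => h; apply/orP; left; lra.
exists (sup E); first exact: ub_le_sup.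
move=> w; have [sw|sw|sw] := ltgtP (s w) 0; last first.
- by rewrite sw mulr0 addr0 below// sw.
- have : - phi w / s w <= sup E by apply: ub_le_sup => //; right; exists w.
  by rewrite ler_pdivrMr//; lra.
have : sup E <= phi w / - s w.
  by apply: ge_sup; [exists 0 | move=> u; exact: slope].
by rewrite ler_pdivlMr ?oppr_gt0//; lra.
Qed.

Lemma pen_multiplier eqn phi s k : 0 <= k -> convex_fct phi -> affine_fct s ->
  (forall w, 0 <= phi w + k * pen eqn (s w)) ->
  exists2 lam, (~~ eqn -> 0 <= lam) & forall w, 0 <= phi w + lam * s w.
Proof.
move=> k0 cphi As; case: eqn => /= pos; last first.
  by have [lam l0 hl] := pos_part_multiplier cphi As pos; exists lam.
have Aneg : affine_fct (fun w => -1 * s w) by exact: affineZ.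
(* an absolute value is the sum of the positive parts of [s] and [- s] *)
have [||lam1 _ h1] := @pos_part_multiplier
    (fun w => phi w + k * Num.max (s w) 0) (fun w => -1 * s w) k _ Aneg.
- by apply: convexD => //; apply: (@convex_pen k false).
- move=> w; apply: (le_trans (pos w)); rewrite -addrA lerD2l -mulrDr.
  apply: ler_wpM2l => //; rewrite mulN1r.
  have h1 : s w <= Num.max (s w) 0 by rewrite le_max lexx.
  have h2 : - s w <= Num.max (- s w) 0 by rewrite le_max lexx.
  have h3 : 0 <= Num.max (s w) 0 by rewrite le_max lexx orbT.
  have h4 : 0 <= Num.max (- s w) 0 by rewrite le_max lexx orbT.
  by rewrite ler_norml; lra.
have [||lam2 _ h2] := @pos_part_multiplier
    (fun w => phi w + lam1 * (-1 * s w)) s k _ As.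
- by apply: convexD => //; apply: affine_convex; apply: affineZ.
- by move=> w; rewrite addrAC.
by exists (lam2 - lam1) => // w; have := h2 w; lra.
Qed.

(** The penalty terms are eliminated one at a time; at each stage those already
    replaced by affine terms are absorbed into the convex function. *)
Lemma sum_pen_multiplier (J : finType) (eqn : pred J) phi (s : J -> V -> R) k :
  0 <= k -> convex_fct phi -> (forall j, affine_fct (s j)) ->
  (forall w, 0 <= phi w + k * \sum_j pen (eqn j) (s j w)) ->
  exists2 mu : J -> R, (forall j, ~~ eqn j -> 0 <= mu j) &
    forall w, 0 <= phi w + \sum_j mu j * s j w.
Proof.
move=> k0 cphi As pos.
suff [mu mu0 hmu] : exists2 mu : J -> R, (forall j, ~~ eqn j -> 0 <= mu j) &
    forall w, 0 <= phi w + \sum_(j <- index_enum J) mu j * s j w by exists mu.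
move: pos; have: uniq (index_enum J) by exact: index_enum_uniq.
elim: (index_enum J) phi cphi => [phi cphi _ pos|j js IH phi cphi].
  by exists (fun=> 0) => // w; have := pos w; rewrite !big_nil mulr0.
move=> /= /andP[jjs ujs] pos.
have [||mu mu0 hmu] := IH (fun w => phi w + k * pen (eqn j) (s j w)) _ ujs.
- by apply: convexD => //; exact: convex_pen.
- by move=> w; have := pos w; rewrite big_cons mulrDr addrA.
have [||lam lam0 hlam] := @pen_multiplier (eqn j)
    (fun w => phi w + \sum_(i <- js) mu i * s i w) (s j) k k0 _ (As j).
- apply: convexD => //; elim: js {IH jjs ujs pos hmu} => [|i js IHs] x y t t01.
    by rewrite !big_nil !mulr0 addr0.
  rewrite !big_cons.
  by have := IHs x y t t01; rewrite (As i) !mulrDr => h; lra.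
- by move=> w; rewrite addrAC.
exists (fun i => if i == j then lam else mu i) => [i|w].
  by case: eqP => [->|_]; [exact: lam0 | exact: mu0].
rewrite big_cons eqxx addrCA addrC; have := hlam w.
rewrite (eq_big_seq (fun i => (if i == j then lam else mu i) * s i w))//.
by move=> i ijs; case: eqP ijs => [->|//]; rewrite (negbTE jjs).
Qed.

End PenaltyMultiplier.

(** * First and second order expansions along converging directions *)

Lemma cvg_sumr {R : realType} {T : Type} {G : set_system T} {FG : Filter G}
    (J : finType) (u : J -> T -> R) (l : J -> R) :
  (forall j, u j @ G --> l j) ->
  (fun a => \sum_j u j a) @ G --> \sum_j l j.
Proof.
by move=> ul; apply: cvg_big => [|j _]; [exact: add_continuous | exact: ul].
Qed.

Lemma near_distP {R : realType} {V : normedModType R} (x : V) (P : V -> Prop) :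
  (\forall y \near x, P y) <->
  exists2 eta : R, 0 < eta & forall y, `|y - x| < eta -> P y.
Proof.
split=> [/nbhs_normP[eta /= eta0 h]|[eta eta0 h]].
  by exists eta => // y yx; apply: h; rewrite /ball_/= distrC.
by apply/nbhs_normP; exists eta => // y; rewrite /ball_/= distrC => /h.
Qed.

Section Calculus.
Context {R : realType} {n : nat}.
Local Notation X := 'rV[R]_n.
Implicit Types (x d v w z : X).

Lemma coord_le_norm k (u : 'rV[R]_k) i : `|u 0 i| <= `|u|.
Proof.
by rewrite [leRHS]/Num.norm /= mx_normrE; apply/bigmax_geP; right; exists (0, i).
Qed.

Lemma diff_bound (W : normedModType R) (F : X -> W) x : differentiable F x ->
  forall e : R, 0 < e ->
  \forall z \near (0 : X), `|F (x + z) - F x - 'd F x z| <= e * `|z|.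
Proof.
move=> /diff_locallyxP[_ dF] e e0; near=> z.
rewrite [x + z]addrC dF -addrA -opprD addrC addKr.
by near: z; apply: littleoP.
Unshelve. all: by end_near. Qed.

Lemma scaled_dir_cvg (T : Type) (G : set_system T) {FG : Filter G}
    (t : T -> R) (v : T -> X) d :
  t @ G --> 0 -> v @ G --> d -> (fun a => t a *: v a) @ G --> (0 : X).
Proof. by move=> t0 vd; rewrite -(scale0r d); exact: cvgZ. Qed.

Lemma bounded_dir (T : Type) (G : set_system T) {FG : Filter G}
    (v : T -> X) d : v @ G --> d -> \forall a \near G, `|v a| <= `|d| + 1.
Proof.
move=> vd; have : (fun a => `|v a|) @ G --> `|d| by exact: cvg_norm.
by move=> /cvgr_le; apply; rewrite ltrDl.
Qed.

(** The direction may vary with the parameter: this covers points [x + t v] with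
    [v] only converging to [d], which is how points of a cone around [d] or of a
    sequence approaching [x] in the direction [d] are described. *)
Lemma diff_quotient_cvg (W : normedModType R) (F : X -> W) x d (T : Type)
    (G : set_system T) {FG : Filter G} (t : T -> R) (v : T -> X) :
  differentiable F x -> (\forall a \near G, 0 < t a) -> t @ G --> 0 ->
  v @ G --> d ->
  (fun a => (t a)^-1 *: (F (x + t a *: v a) - F x)) @ G --> 'd F x d.
Proof.
move=> dF tpos t0 vd.
have cd : (fun a => 'd F x (v a)) @ G --> 'd F x d.
  apply: continuous_cvg => //; exact: (diff_continuous dF).
have -> : (fun a => (t a)^-1 *: (F (x + t a *: v a) - F x)) = fun a =>
    ((t a)^-1 *: (F (x + t a *: v a) - F x) - 'd F x (v a)) + 'd F x (v a).
  by apply/funext => a; rewrite subrK.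
rewrite -['d F x d]add0r; apply: cvgD => //; apply/cvgrPdist_le => e e0.
have d1 : 0 < `|d| + 1 by rewrite ltr_wpDl.
have := diff_bound dF (divr_gt0 e0 d1).
move=> /(scaled_dir_cvg t0 vd) hb.
near=> a; rewrite sub0r normrN.
have ta : 0 < t a by near: a.
have -> : (t a)^-1 *: (F (x + t a *: v a) - F x) - 'd F x (v a) =
  (t a)^-1 *: (F (x + t a *: v a) - F x - 'd F x (t a *: v a)).
  by rewrite (linearZZ ('d F x)) [RHS]scalerBr scalerA mulVf ?gt_eqF// scale1r.
rewrite normrZ gtr0_norm ?invr_gt0// ler_pdivrMl//.
have va : `|v a| <= `|d| + 1 by near: a; exact: bounded_dir.
apply: le_trans (_ : e / (`|d| + 1) * `|t a *: v a| <= _); first by near: a.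
rewrite normrZ (gtr0_norm ta) mulrCA ler_wpM2l ?(ltW ta)//.
by rewrite mulrAC ler_pdivrMr// ler_wpM2l// ltW.
Unshelve. all: by end_near. Qed.

Lemma diff_coords (W : normedModType R) (F : X -> W) x z :
  'd F x z = \sum_i z 0 i *: 'd F x 'e_i.
Proof.
rewrite {1}(row_sum_delta z) linear_sum; apply: eq_bigr => i _.
by rewrite linearZ.
Qed.

Lemma line_derive (F : X -> R) x z (s : R) : differentiable F (x + s *: z) ->
  is_derive s 1 (fun s => F (x + s *: z)) ('d F (x + s *: z) z).
Proof.
move=> dF; pose L := fun s : R => x + s *: z.
have dL : is_diff s L ( *:%R^~ z).
  have := is_diffD (is_diff_cst x s) (is_diff_scalel s z).
  by rewrite add0r.
have dFL : differentiable (F \o L) s.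
  by case: (dL) => dL' _; exact: differentiable_comp.
apply: DeriveDef; first exact: diff_derivable.
rewrite (deriveE _ dFL) diff_comp//=.
have -> : 'd L s = *:%R^~ z :> (R -> X) by case: dL.
by rewrite scale1r.
Qed.

Lemma mulr_derive (k s : R) : is_derive s 1 (fun s : R => s * k) k.
Proof.
have ds := is_diff_scalel s k.
apply: DeriveDef; first exact: diff_derivable.
by rewrite deriveE// diff_val scale1r.
Qed.

Lemma quadratic_shift_derive (b : R -> R) (db k c s : R) : is_derive s 1 b db ->
  is_derive s 1 (fun s => b s - s * k - s * (s * (2^-1 * c))) (db - k - s * c).
Proof.
move=> hb.
have dq := is_deriveM (is_derive_id s (1 : R)) (mulr_derive (2^-1 * c) s).
apply: (is_derive_eq (is_deriveB (is_deriveB hb (mulr_derive k s)) dq)).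
by rewrite /GRing.scale/= mulr1; field.
Qed.

Lemma is_diff_linear_comb (J : finType) (mu : J -> R) (c : J -> X -> R) x :
  (forall j, differentiable (c j) x) ->
  is_diff x (fun y => \sum_j mu j * c j y)
            (fun v => \sum_j mu j * 'd (c j) x v).
Proof.
move=> dc.
have -> : (fun y => \sum_j mu j * c j y) = \sum_j (mu j *: c j).
  by apply/funext => y; rewrite fct_sumE.
have -> : (fun v => \sum_j mu j * 'd (c j) x v) =
    \sum_j (mu j *: ('d (c j) x : X -> R)).
  by apply/funext => y; rewrite fct_sumE.
elim/big_rec2: _ => [|j df f _ h]; first exact: is_diff_cst.
by apply: is_diffD => //; apply: is_diffZ; exact: differentiableP.
Qed.

(** Asking only for a pointwise equality makes the formula applicable to
    functions that are not syntactically sums, such as [y |-> 'd F y v]. *)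
Lemma diff_linear_combE (J : finType) (mu : J -> R) (c : J -> X -> R) (G : X -> R)
    x v : (forall j, differentiable (c j) x) ->
  (forall y, G y = \sum_j mu j * c j y) ->
  'd G x v = \sum_j mu j * 'd (c j) x v :> R.
Proof. by move=> dc /funext ->; have [_ ->] := is_diff_linear_comb mu dc. Qed.

(** The mean value theorem on the segment from [y] to [z] reduces the claim to
    the continuity at [x] of the partial derivatives. *)
Lemma C1_strict_diff (F : X -> R) x : C1 F -> forall e : R, 0 < e ->
  exists2 eta : R, 0 < eta & forall y z, `|y - x| < eta -> `|z - x| < eta ->
    `|F z - F y - 'd F x (z - y)| <= e * `|z - y|.
Proof.
move=> [dF cF] e e0.
have n1 : 0 < n.+1%:R :> R by rewrite ltr0n.
have hi (i : 'I_n) : \forall y \near x,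
    `|'d F y 'e_i - 'd F x 'e_i| <= e / n.+1%:R.
  by have /cvgrPdistC_le/(_ _ (divr_gt0 e0 n1)) := cF 'e_i x; exact.
have [eta eta0 heta] := (near_distP _ _).1 (filter_forall _ hi).
exists eta => // y z yx zx.
pose a s := F (y + s *: (z - y)) - s * 'd F x (z - y).
have da (s : R) : is_derive s 1 a
    ('d F (y + s *: (z - y)) (z - y) - 'd F x (z - y)).
  by apply: is_deriveB; [exact: line_derive | exact: mulr_derive].
have ca : {within `[0, 1], continuous a}.
  apply: continuous_subspaceT => s; apply: differentiable_continuous.
  by apply/derivable1_diffP; case: (da s).
have [s + ] := MVT ltr01 (fun s _ => da s) ca.
rewrite in_itv/= => /andP[s0 s1].
rewrite /a scale1r scale0r addr0 mul0r !subr0 mul1r [y + _]addrC subrK mulr1.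
move=> E; have -> : F z - F y - 'd F x (z - y) =
    'd F (y + s *: (z - y)) (z - y) - 'd F x (z - y).
  by rewrite -E; ring.
have {}heta : forall i, `|'d F (y + s *: (z - y)) 'e_i - 'd F x 'e_i|
    <= e / n.+1%:R.
  apply: heta.
  have -> : y + s *: (z - y) - x = (1 - s) *: (y - x) + s *: (z - x).
    by apply/rowP => i; rewrite !mxE; ring.
  have s1' : 0 < 1 - s by rewrite subr_gt0.
  apply: le_lt_trans (ler_normD _ _) _.
  rewrite !normrZ (gtr0_norm s0) (gtr0_norm s1').
  have h1 : (1 - s) * `|y - x| < (1 - s) * eta by rewrite ltr_pM2l.
  have h2 : s * `|z - x| < s * eta by rewrite ltr_pM2l.
  by apply: lt_le_trans (ltrD h1 h2) _; rewrite -mulrDl subrK mul1r.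
rewrite [X in X - _]diff_coords [X in _ - X]diff_coords -sumrB.
apply: le_trans (ler_norm_sum _ _ _) _.
apply: le_trans (_ : \sum_(i < n) `|z - y| * (e / n.+1%:R) <= _).
  apply: ler_sum => i _; rewrite -scalerBr normrZ.
  by apply: ler_pM => //; exact: coord_le_norm.
rewrite sumr_const card_ord -[leLHS]mulr_natr.
move: `|_| (normr_ge0 (z - y)) => N N0.
have -> : N * (e / n.+1%:R) * n%:R = e * N * (n%:R / n.+1%:R) by ring.
apply: ler_piMr; first by rewrite mulr_ge0// ltW.
by rewrite ler_pdivrMr// mul1r ler_nat.
Qed.

Definition pder (F : X -> R) (i : 'I_n) : X -> R := fun y => 'd F y 'e_i.

Definition second_diff (F : X -> R) x v w : R := 'd (fun y => 'd F y w : R) x v.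

Lemma second_diffE (F : X -> R) x v w : C2 F ->
  second_diff F x v w = \sum_i w 0 i * 'd (pder F i) x v.
Proof.
move=> [_ dF2]; apply: diff_linear_combE => [i|y]; first exact: (dF2 'e_i).1.
exact: (diff_coords F y w).
Qed.

(** The partial derivatives are differentiable at [x], so their increments along
    the segment from [x] to [x + z] are linear up to [e * `|z|], uniformly. *)
Lemma gradient_increment_bound (F : X -> R) x : C2 F -> forall e : R, 0 < e ->
  exists2 eta : R, 0 < eta & forall z (s : R), `|z| < eta -> 0 <= s <= 1 ->
    `|'d F (x + s *: z) z - 'd F x z - s * second_diff F x z z|
      <= e * (`|z| * `|z|).
Proof.
move=> [dF2' dF2] e e0; have [dF _] := dF2'.
have n1 : 0 < n.+1%:R :> R by rewrite ltr0n.
have hi (i : 'I_n) : \forall w \near (0 : X),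
    `|pder F i (x + w) - pder F i x - 'd (pder F i) x w| <= e / n.+1%:R * `|w|.
  by apply: diff_bound; [exact: (dF2 'e_i).1 | exact: divr_gt0].
have [eta eta0 heta] := (near_distP _ _).1 (filter_forall _ hi).
exists eta => // z s zeta /andP[s0 s1].
rewrite (second_diffE x z z (conj dF2' dF2)).
rewrite [X in X - _ - _]diff_coords [X in _ - X - _]diff_coords.
rewrite mulr_sumr -!sumrB.
apply: le_trans (ler_norm_sum _ _ _) _.
apply: le_trans (_ : \sum_(i < n) `|z| * (e / n.+1%:R * `|z|) <= _).
  apply: ler_sum => i _.
  have := heta (s *: z); rewrite subr0 normrZ (ger0_norm s0).
  move=> /(_ _ i) h.
  have {}h := h (le_lt_trans (ler_piMl (normr_ge0 z) s1) zeta).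
  rewrite (linearZZ ('d (pder F i) x)) in h.
  rewrite /GRing.scale/=.
  rewrite mulrCA -!mulrBr normrM; apply: ler_pM => //; first exact: coord_le_norm.
  apply: le_trans h _; rewrite ler_wpM2l//; first by rewrite divr_ge0// ltW.
  exact: ler_piMl.
rewrite sumr_const card_ord -[leLHS]mulr_natr; move: `|_| (normr_ge0 z) => N N0.
have -> : N * (e / n.+1%:R * N) * n%:R = e * (N * N) * (n%:R / n.+1%:R) by ring.
apply: ler_piMr; first by rewrite !mulr_ge0// ltW.
by rewrite ler_pdivrMr// mul1r ler_nat.
Qed.

(** The mean value theorem applied to the Taylor remainder along the segment. *)
Lemma C2_taylor (F : X -> R) x : C2 F -> forall e : R, 0 < e ->
  exists2 eta : R, 0 < eta & forall z, `|z| < eta ->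
    `|F (x + z) - F x - 'd F x z - 2^-1 * second_diff F x z z|
      <= e * (`|z| * `|z|).
Proof.
move=> CF e e0; have [eta eta0 heta] := gradient_increment_bound x CF e0.
have [[dF _] _] := CF; exists eta => // z zeta.
pose q : R := second_diff F x z z.
pose a s := F (x + s *: z) - s * 'd F x z - s * (s * (2^-1 * q)).
have da (s : R) : is_derive s 1 a ('d F (x + s *: z) z - 'd F x z - s * q).
  by apply: quadratic_shift_derive; exact: line_derive.
have ca : {within `[0, 1], continuous a}.
  apply: continuous_subspaceT => s; apply: differentiable_continuous.
  by apply/derivable1_diffP; case: (da s).
have [s + ] := MVT ltr01 (fun s _ => da s) ca.
rewrite in_itv/= => /andP[s0 s1].
rewrite /a scale1r scale0r addr0 !mul0r !subr0 !mul1r mulr1 => E.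
have := heta z s zeta; rewrite (ltW s0) (ltW s1) => /(_ isT).
have alg (a1 a2 a3 a4 : R) : a1 - a2 - a3 - a4 = a1 - a4 - a2 - a3 by ring.
by rewrite -/q -E alg.
Qed.

End Calculus.
(** * Closure of smoothness under linear combinations, gradients and Hessians *)

Lemma near_cvg_eq {R : realType} {T : Type} {G : set_system T} {FG : Filter G}
    (u v : T -> R) (l : R) :
  (\forall a \near G, u a = v a) -> u @ G --> l -> v @ G --> l.
Proof. by move=> uv ul; apply: cvg_trans ul; exact: near_eq_cvg. Qed.

Section Smooth.
Context {R : realType} {n : nat}.
Local Notation X := 'rV[R]_n.
Implicit Types (x d v w z : X) (f F : X -> R).

Lemma dotpE k (u v : 'rV[R]_k) : dotp u v = (u *m v^T) 0 0.
Proof. by rewrite mxE; apply: eq_bigr => i _; rewrite mxE. Qed.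

Lemma dotpC k (u v : 'rV[R]_k) : dotp u v = dotp v u.
Proof. by apply: eq_bigr => i _; rewrite mulrC. Qed.

Lemma dotpDr k (u v w : 'rV[R]_k) : dotp u (v + w) = dotp u v + dotp u w.
Proof. by rewrite !dotpE linearD/= mulmxDr mxE. Qed.

Lemma dotpZr k (u v : 'rV[R]_k) t : dotp u (t *: v) = t * dotp u v.
Proof. by rewrite !dotpE linearZ/= -scalemxAr mxE. Qed.

Lemma dotpDl k (u v w : 'rV[R]_k) : dotp (v + w) u = dotp v u + dotp w u.
Proof. by rewrite !(dotpC _ u) dotpDr. Qed.

Lemma dotpZl k (u v : 'rV[R]_k) t : dotp (t *: v) u = t * dotp v u.
Proof. by rewrite !(dotpC _ u) dotpZr. Qed.

Lemma dotp_e k (u : 'rV[R]_k) i : dotp 'e_i u = u 0 i.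
Proof.
rewrite /dotp (bigD1 i)//= big1 ?addr0 => [|j ji]; rewrite mxE eqxx/=.
  by rewrite eqxx mul1r.
by rewrite (negbTE ji) mul0r.
Qed.

Lemma dotp_suml k (J : finType) (Q : pred J) (u : J -> 'rV[R]_k)
    (v : 'rV[R]_k) :
  dotp (\sum_(j | Q j) u j) v = \sum_(j | Q j) dotp (u j) v.
Proof.
by rewrite dotpE mulmx_suml summxE; apply: eq_bigr => j _; rewrite dotpE.
Qed.

Lemma dotp_continuous k (u : 'rV[R]_k) : continuous (dotp u : 'rV[R]_k -> R).
Proof.
move=> v; rewrite /continuous_at /dotp.
have h i : continuous (fun w : 'rV[R]_k => u 0 i * w 0 i : R).
  by move=> w; exact: (cvgM (cvg_cst _) (@coord_continuous R 1 k 0 i w)).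
exact: (cvg_sumr (fun i => h i v)).
Qed.

Lemma grad_dotp F x v : differentiable F x -> 'd F x v = dotp (grad F x) v.
Proof.
move=> dF; rewrite diff_coords; apply: eq_bigr => i _.
by rewrite mxE deriveE// mulrC.
Qed.

Definition curv F x d : R := (d *m hessian F x *m d^T) 0 0.

Lemma curv_second_diff F x d : C2 F -> curv F x d = second_diff F x d d.
Proof.
move=> CF; have [[dF _] dF2] := CF.
have pE j : 'D_('e_j) F = pder F j.
  by apply/funext => y; rewrite deriveE.
rewrite second_diffE// /curv mxE; apply: eq_bigr => j _.
rewrite !mxE mulrC; congr (_ * _).
have dp : differentiable (pder F j) x by have [] := dF2 'e_j.
rewrite diff_coords; apply: eq_bigr => i _.
by rewrite mxE pE deriveE.
Qed.

Section LinearCombination.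
Variables (J : finType) (mu : J -> R) (f : X -> R) (c : J -> X -> R).

Definition affine_comb x : R := f x + \sum_j mu j * c j x.

Lemma is_diff_affine_comb x : differentiable f x ->
  (forall j, differentiable (c j) x) ->
  is_diff x affine_comb (fun v => 'd f x v + \sum_j mu j * 'd (c j) x v).
Proof.
move=> df dc.
exact: (is_diffD (differentiableP df) (is_diff_linear_comb mu dc)).
Qed.

Lemma diff_affine_comb x v : C1 f -> (forall j, C1 (c j)) ->
  'd affine_comb x v = 'd f x v + \sum_j mu j * 'd (c j) x v :> R.
Proof.
move=> [df _] Cc; have dc j : differentiable (c j) x by have [] := Cc j.
by have [_ /(congr1 (fun l => l v))] := is_diff_affine_comb (df x) dc.
Qed.

Lemma diff_eq_affine_comb (G : X -> R) x v : C1 f -> (forall j, C1 (c j)) ->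
  (forall y, G y = affine_comb y) ->
  'd G x v = 'd f x v + \sum_j mu j * 'd (c j) x v :> R.
Proof. by move=> Cf Cc /funext ->; exact: diff_affine_comb. Qed.

Lemma C1_affine_comb : C1 f -> (forall j, C1 (c j)) -> C1 affine_comb.
Proof.
move=> Cf Cc; split=> [x|v].
  have [df _] := Cf; have dc j : differentiable (c j) x by have [] := Cc j.
  by have [] := is_diff_affine_comb (df x) dc.
under eq_fun do rewrite diff_affine_comb//.
have h j : continuous (fun y => mu j * 'd (c j) y v : R).
  by move=> y; have [_ /(_ v y) h] := Cc j; exact: (cvgM (cvg_cst _) h).
move=> x; have [_ /(_ v x) hf] := Cf.
exact: (cvgD hf (cvg_sumr (fun j => h j x))).
Qed.

End LinearCombination.

Lemma C2_affine_comb (J : finType) (mu : J -> R) f (c : J -> X -> R) :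
  C2 f -> (forall j, C2 (c j)) -> C2 (affine_comb mu f c).
Proof.
move=> [Cf Cf2] Cc; have Cc1 j : C1 (c j) by case: (Cc j).
split; first exact: C1_affine_comb.
move=> v; have -> : (fun x => 'd (affine_comb mu f c) x v : R) =
    affine_comb mu (fun x => 'd f x v : R) (fun j x => 'd (c j) x v : R).
  by apply/funext => x; exact: diff_affine_comb.
apply: C1_affine_comb; first exact: Cf2.
by move=> j; have [_] := Cc j; apply.
Qed.

Lemma curv_affine_comb (J : finType) (mu : J -> R) f (c : J -> X -> R) x d :
  C2 f -> (forall j, C2 (c j)) ->
  curv (affine_comb mu f c) x d = curv f x d + \sum_j mu j * curv (c j) x d.
Proof.
move=> Cf Cc; rewrite (curv_second_diff x d (C2_affine_comb mu Cf Cc)).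
rewrite (curv_second_diff x d Cf).
under eq_bigr => j _ do rewrite (curv_second_diff x d (Cc j)).
have Cc1 j : C1 (c j) by case: (Cc j).
apply: diff_eq_affine_comb => [||y].
- by have [_] := Cf; apply.
- by move=> j; have [_] := Cc j; apply.
- by apply: diff_affine_comb => //; have [] := Cf.
Qed.

Lemma dotp_is_linear k (a : 'rV[R]_k) : linear (dotp a : 'rV[R]_k -> R).
Proof. by move=> t u v; rewrite dotpDr dotpZr. Qed.

Lemma is_diff_dotp k (a : 'rV[R]_k) (F : X -> 'rV[R]_k) x :
  differentiable F x ->
  is_diff x (fun y => dotp a (F y)) (fun v => dotp a ('d F x v)).
Proof.
move=> dF; pose lM := GRing.isLinear.Build _ _ _ _ _ (dotp_is_linear a).
pose l : {linear 'rV[R]_k -> R} := HB.pack (dotp a : 'rV[R]_k -> R) lM.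
have cl : continuous l by exact: dotp_continuous.
have dl : is_diff (F x) l l.
  by apply: DiffDef; [exact: linear_differentiable | exact: diff_lin].
exact: (is_diff_comp (differentiableP dF) dl).
Qed.

Lemma diff_dotp k (a : 'rV[R]_k) (F : X -> 'rV[R]_k) x v :
  differentiable F x -> 'd (fun y => dotp a (F y)) x v = dotp a ('d F x v) :> R.
Proof. by move=> dF; have [_ ->] := is_diff_dotp a dF. Qed.

Lemma diff_eq_dotp k (a : 'rV[R]_k) (F : X -> 'rV[R]_k) (G : X -> R) x v :
  differentiable F x -> (forall y, G y = dotp a (F y)) ->
  'd G x v = dotp a ('d F x v) :> R.
Proof. by move=> dF /funext ->; exact: diff_dotp. Qed.

Lemma C1_dotp k (a : 'rV[R]_k) (F : X -> 'rV[R]_k) :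
  C1 F -> C1 (fun y => dotp a (F y) : R).
Proof.
move=> [dF cF]; split=> [x|v x]; first by have [] := is_diff_dotp a (dF x).
under eq_fun do rewrite diff_dotp//.
by apply: continuous_comp; [exact: cF | exact: dotp_continuous].
Qed.

Lemma C2_dotp k (a : 'rV[R]_k) (F : X -> 'rV[R]_k) :
  C2 F -> C2 (fun y => dotp a (F y) : R).
Proof.
move=> [CF CF2]; split; first exact: C1_dotp.
move=> v; have -> : (fun x => 'd (fun y => dotp a (F y) : R) x v : R) =
    fun x => dotp a ('d F x v).
  by apply/funext => x; apply: diff_dotp; case: CF.
exact: C1_dotp (CF2 v).
Qed.

Lemma second_diffZ F x z t : C2 F ->
  second_diff F x (t *: z) (t *: z) = t * t * second_diff F x z z.
Proof.
move=> CF; rewrite !second_diffE// mulr_sumr; apply: eq_bigr => i _.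
by rewrite mxE (linearZZ ('d (pder F i) x)) /GRing.scale/=; ring.
Qed.

Lemma second_diff_continuous F x : C2 F ->
  continuous (fun z => second_diff F x z z).
Proof.
move=> CF; under eq_fun do rewrite second_diffE//.
have h i : continuous (fun z => z 0 i * ('d (pder F i) x z : R)).
  move=> z; have dp : differentiable (pder F i) x.
    by have [_ dF2] := CF; have [] := dF2 'e_i.
  have cd : continuous ('d (pder F i) x : X -> R) by exact: diff_continuous.
  exact: (cvgM (@coord_continuous R 1 n 0 i z) (cd z)).
by move=> z; exact: (cvg_sumr (fun i => h i z)).
Qed.

(** Taylor's formula in quotient form, for directions converging to [d].  The
    first-order term is taken along the moving direction [v a], not along [d]:
    their difference is in general not negligible after division by [t ^ 2]. *)
Lemma second_quotient_cvg F x d (T : Type) (G : set_system T) {FG : Filter G}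
    (t : T -> R) (v : T -> X) :
  C2 F -> (\forall a \near G, 0 < t a) -> t @ G --> 0 -> v @ G --> d ->
  (fun a => (t a * t a)^-1 * (F (x + t a *: v a) - F x - t a * 'd F x (v a)))
    @ G --> 2^-1 * curv F x d.
Proof.
move=> CF tpos t0 vd; rewrite curv_second_diff//.
pose q z := second_diff F x z z.
have cq : (fun a => 2^-1 * q (v a)) @ G --> 2^-1 * q d.
  have cq0 : (fun a => q (v a)) @ G --> q d.
    exact: (cvg_comp _ _ vd (@second_diff_continuous F x CF d)).
  exact: (cvgM (cvg_cst _) cq0).
pose rem a := (t a * t a)^-1 *
  (F (x + t a *: v a) - F x - 'd F x (t a *: v a) - 2^-1 * q (t a *: v a)).
suff rem0 : rem @ G --> 0.
  have eqs : \forall a \near G, rem a + 2^-1 * q (v a) = (t a * t a)^-1 *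
      (F (x + t a *: v a) - F x - t a * 'd F x (v a)).
    near=> a; have ta : 0 < t a by near: a.
    rewrite /rem /q second_diffZ// (linearZZ ('d F x)) /GRing.scale/=.
    move: (F (x + _)) (F x) ('d F x _ : R) (second_diff _ _ _ _) => r1 r2 r3 r4.
    by field; rewrite gt_eqF.
  have := cvgD rem0 cq; rewrite add0r => h.
  exact: (near_cvg_eq eqs (h _)).
apply/cvgrPdist_le => e e0.
have d1 : 0 < `|d| + 1 by rewrite ltr_wpDl.
have e1 : 0 < e / ((`|d| + 1) * (`|d| + 1)) by rewrite divr_gt0// mulr_gt0.
have [eta eta0 heta] := C2_taylor x CF e1.
have hb : \forall a \near G, `|t a *: v a| < eta.
  exact: (cvgr0_norm_lt _ (scaled_dir_cvg t0 vd)).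
near=> a; rewrite sub0r normrN.
have ta : 0 < t a by near: a.
have tt : 0 < t a * t a by rewrite mulr_gt0.
rewrite /rem normrM gtr0_norm ?invr_gt0// ler_pdivrMl//.
have va : `|v a| <= `|d| + 1 by near: a; exact: bounded_dir.
apply: le_trans (heta (t a *: v a) _) _; first by near: a.
rewrite normrZ (gtr0_norm ta).
move: `|v a| `|d| (normr_ge0 (v a)) va d1 => N D N0 ND D1 {e1 heta}.
have -> : e / ((D + 1) * (D + 1)) * (t a * N * (t a * N)) =
  t a * t a * (e * ((N / (D + 1)) * (N / (D + 1)))).
  by field; rewrite gt_eqF.
apply: ler_wpM2l; [exact: ltW|apply: ler_piMr; first exact: ltW].
have N1 : N / (D + 1) <= 1 by rewrite ler_pdivrMr// mul1r.
by apply: mulr_ile1 => //; rewrite divr_ge0// ltW.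
Unshelve. all: by end_near. Qed.

End Smooth.

(** * From a directional penalty inequality to multipliers *)

Notation dirf R d := (filter_prod (0 : R)^'+ (nbhs d)).

Section DirectionalFilter.
Context {R : realType} {n : nat} (d : 'rV[R]_n).
Implicit Types p : R * 'rV[R]_n.

Lemma dirf_fst : (fun p => p.1) @ dirf R d --> (0 : R)^'+.
Proof. exact: cvg_fst. Qed.

Lemma dirf_pos : \forall p \near dirf R d, 0 < p.1.
Proof. exact: (dirf_fst (nbhs_right_gt 0)). Qed.

Lemma dirf_lt (e : R) : 0 < e -> \forall p \near dirf R d, p.1 < e.
Proof. by move=> e0; exact: (dirf_fst (nbhs_right_lt e0)). Qed.

Lemma dirf_fst0 : (fun p => p.1) @ dirf R d --> (0 : R).
Proof. by apply: cvg_trans dirf_fst _; exact: cvg_within. Qed.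

Lemma dirf_snd : (fun p => p.2) @ dirf R d --> d.
Proof. exact: cvg_snd. Qed.

Lemma dirf_dist (e : R) : 0 < e -> \forall p \near dirf R d, `|p.2 - d| < e.
Proof. 
move=> e0; apply: (@dirf_snd (fun v => `|v - d| < e)).
by apply/(near_distP d); exists e.
Qed.

Lemma dirf_base x : (fun p => x + p.1 *: p.2) @ dirf R d --> x.
Proof.
have h : (fun p => x + p.1 *: p.2) @ dirf R d --> x + 0 *: d.
  by apply: (cvgD (cvg_cst _)); exact: cvgZ dirf_fst0 dirf_snd.
by rewrite scale0r addr0 in h.
Qed.

Lemma dirf_quotient (F : 'rV[R]_n -> R) x : differentiable F x ->
  (fun p => p.1^-1 * (F (x + p.1 *: p.2) - F x)) @ dirf R d --> 'd F x d.
Proof. by move=> dF; exact: (diff_quotient_cvg dF dirf_pos dirf_fst0 dirf_snd). Qed.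

End DirectionalFilter.

Section Penalized.
Context {R : realType} {n : nat}.
Local Notation X := 'rV[R]_n.
Implicit Types (d v w : X).

Lemma cvg_ge0 (T : Type) (G : set_system T) {PG : ProperFilter G}
    (u : T -> R) (l : R) :
  u @ G --> l -> (\forall a \near G, 0 <= u a) -> 0 <= l.
Proof.
move=> ul u0.
exact: (closed_cvg (fun r : R => 0 <= r) (@closed_ge _ 0) u0 l ul).
Qed.

Lemma pen_cvg eqn (T : Type) (G : set_system T) {FG : Filter G}
    (u : T -> R) (l : R) :
  u @ G --> l -> (fun a => pen eqn (u a)) @ G --> pen eqn l.
Proof.
move=> ul; rewrite /pen; case: eqn; first exact: cvg_norm.
have maxE (r : R) : Num.max r 0 = 2^-1 * (r + `|r|).
  by rewrite maxr_absE addr0 subr0 mulrC.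
rewrite maxE; under eq_fun do rewrite maxE.
exact: (cvgM (cvg_cst _) (cvgD ul (cvg_norm ul))).
Qed.

Lemma linear_bounded_below (l : {linear X -> R}) (C : R) :
  (forall w, 0 <= l w + C) -> 0 <= C /\ forall w, l w = 0.
Proof.
move=> h; have C0 : 0 <= C by have := h 0; rewrite linear0 add0r.
split=> // w; apply/eqP/negPn/negP => lw.
have := h ((- (C + 1) / l w) *: w); rewrite linearZZ /GRing.scale/= divfK//.
by lra.
Qed.

Variables (J : finType) (eqn : pred J) (f : X -> R) (c : J -> X -> R).
Variables (x d : X) (k : R).

(** Exact penalization in the direction [d]: the filter describes [t] tending to
    [0] from above and [v] tending to [d], that is, cones around [d] truncated near
    the origin (full neighbourhoods of [x] when [d = 0]). *)
Definition penalized : Prop :=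
  \forall p \near dirf R d,
    f x <= f (x + p.1 *: p.2)
           + k * \sum_j pen (eqn j) (c j (x + p.1 *: p.2)).

(** Dividing the penalty inequality by a scale [s] and passing to the limit.  The
    term [tau * 'd f x d] may be subtracted because it is nonpositive. *)
Lemma penalized_limit (T : Type) (G : set_system T) {PG : ProperFilter G}
    (y : T -> X) (s tau : T -> R) (gf : R) (gc : J -> R) :
  'd f x d <= 0 ->
  (\forall a \near G, 0 < s a) -> (\forall a \near G, 0 <= tau a) ->
  (\forall a \near G, f x <= f (y a) + k * \sum_j pen (eqn j) (c j (y a))) ->
  (fun a => (s a)^-1 * (f (y a) - f x - tau a * 'd f x d)) @ G --> gf ->
  (forall j, (fun a => (s a)^-1 * c j (y a)) @ G --> gc j) ->
  0 <= gf + k * \sum_j pen (eqn j) (gc j).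
Proof.
move=> fd s0 tau0 hpen hf hc.
have hs : (fun a => (s a)^-1 * (f (y a) - f x - tau a * 'd f x d) +
    k * \sum_j pen (eqn j) ((s a)^-1 * c j (y a))) @ G -->
    gf + k * \sum_j pen (eqn j) (gc j).
  apply: (cvgD hf (cvgM (cvg_cst k) _)).
  by apply: (cvg_sumr (u := fun j a => pen (eqn j) ((s a)^-1 * c j (y a)))) => j;
     exact: pen_cvg.
apply: (cvg_ge0 hs); near=> a.
have sa : 0 < s a by near: a.
have ta : 0 <= tau a by near: a.
have : f x <= f (y a) + k * \sum_j pen (eqn j) (c j (y a)) by near: a.
rewrite /=; under [X in _ -> is_true (_ <= _ + _ * X)]eq_bigr => j _.
  by rewrite penM ?invr_ge0 ?(ltW sa)//; over.
rewrite -mulr_sumr mulrCA -mulrDr => h; rewrite mulr_ge0 ?invr_ge0 ?(ltW sa)//.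
have : tau a * 'd f x d <= 0 by rewrite mulr_ge0_le0.
by move: h; move: (f x) (f _) (k * _) (tau a * _) => a1 a2 a3 a4; lra.
Unshelve. all: by end_near. Qed.

Hypothesis (pen_fc : penalized).
Hypothesis (Cf : C1 f) (Cc : forall j, C1 (c j)).
Hypothesis (cx : forall j, c j x = 0) (cd : forall j, 'd (c j) x d = 0).
Hypothesis (fd : 'd f x d <= 0).

Lemma penalized_first_order w :
  0 <= 'd f x w + k * \sum_j pen (eqn j) ('d (c j) x w).
Proof.
have [[A B]/= [A0 /near_distP[e e0 eB]] AB] := pen_fc.
have w1 : 0 < `|w| + 1 by rewrite ltr_wpDl.
have [r r0 rw] : exists2 r : R, 0 < r & `|r *: w| < e.
  exists (e / (`|w| + 1)); first by rewrite divr_gt0.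
  rewrite normrZ gtr0_norm ?divr_gt0// mulrAC ltr_pdivrMr//.
  by rewrite ltr_pM2l// ltrDl.
have t0 : (fun t : R => t) @ (0 : R)^'+ --> (0 : R).
  by apply: cvg_within_filter; exact: cvg_id.
have tpos : \forall t \near (0 : R)^'+, 0 < t by exact: nbhs_right_gt.
(* for a C1 function only a fixed displacement of the direction is affordable,
   so the base direction is [d + r w] and the rescaled time is [r t] *)
pose y t := x + t *: (d + r *: w).
have quot (F : X -> R) : C1 F ->
    (fun t => t^-1 * (F (y t) - F x)) @ (0 : R)^'+ --> ('d F x (d + r *: w) : R).
  move=> [dF _]; exact: (diff_quotient_cvg (dF x) tpos t0 (cvg_cst _)).
have dE (F : X -> R) : r^-1 * ('d F x (d + r *: w) - 'd F x d) = 'd F x w.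
  by rewrite linearD (linearZZ ('d F x)) /GRing.scale/= addrC addKr mulKf ?gt_eqF.
apply: (@penalized_limit _ (0 : R)^'+ _ y (fun t => r * t) id) => //.
- by near=> t; rewrite mulr_gt0//; near: t.
- by near=> t; rewrite ltW//; near: t.
- near=> t; apply: (AB (t, d + r *: w)); split => /=; first by near: t.
  by apply: eB; rewrite addrC addKr.
- have h : (fun t => r^-1 * (t^-1 * (f (y t) - f x) - 'd f x d)) @ (0 : R)^'+ -->
      'd f x w.
    rewrite -dE; exact: (cvgM (cvg_cst _) (cvgB (quot _ Cf) (cvg_cst _))).
  apply: near_cvg_eq h; near=> t; have ta : 0 < t by near: t.
  move: (f (y t)) (f x) ('d f x d : R) => a1 a2 a3; field.
  by rewrite !gt_eqF.
- move=> j; have h : (fun t => r^-1 * (t^-1 * (c j (y t) - c j x) - 'd (c j) x d))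
      @ (0 : R)^'+ --> 'd (c j) x w.
    rewrite -dE; exact: (cvgM (cvg_cst _) (cvgB (quot _ (Cc j)) (cvg_cst _))).
  apply: near_cvg_eq h; near=> t; have ta : 0 < t by near: t.
  rewrite cx cd !subr0; move: (c j (y t)) => a1; field.
  by rewrite !gt_eqF.
Unshelve. all: by end_near. Qed.

Lemma penalized_second_order w : C2 f -> (forall j, C2 (c j)) ->
  0 <= ('d f x w + curv f x d)
       + k * \sum_j pen (eqn j) ('d (c j) x w + curv (c j) x d).
Proof.
move=> C2f C2c.
have t0 : (fun t : R => t) @ (0 : R)^'+ --> (0 : R).
  by apply: cvg_within_filter; exact: cvg_id.
have tpos : \forall t \near (0 : R)^'+, 0 < t by exact: nbhs_right_gt.
pose v (t : R) := d + (2^-1 * t) *: w.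
have vd : v @ (0 : R)^'+ --> d.
  have h : v @ (0 : R)^'+ --> d + (2^-1 * 0) *: w.
    apply: (cvgD (cvg_cst _)); apply: cvgZ (cvg_cst _).
    exact: cvgM (cvg_cst _) t0.
  by rewrite mulr0 scale0r addr0 in h.
(* a parabolic arc whose velocity is [d] and whose acceleration is [w] *)
pose y t := x + t *: v t.
have quot (F : X -> R) : C2 F ->
    (fun t => (2^-1 * (t * t))^-1 * (F (y t) - F x - t * 'd F x d))
      @ (0 : R)^'+ --> 'd F x w + curv F x d.
  move=> CF.
  have h : (fun t => 'd F x w + 2 * ((t * t)^-1 *
      (F (x + t *: v t) - F x - t * 'd F x (v t)))) @ (0 : R)^'+ -->
      'd F x w + 2 * (2^-1 * curv F x d).
    apply: (cvgD (cvg_cst _)); apply: (cvgM (cvg_cst _)).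
    exact: (second_quotient_cvg CF tpos t0 vd).
  rewrite mulVKf ?pnatr_eq0// in h.
  apply: near_cvg_eq h; near=> t; have ta : 0 < t by near: t.
  have -> : 'd F x (v t) = 'd F x d + 2^-1 * t * 'd F x w :> R.
    by rewrite linearD (linearZZ ('d F x)).
  rewrite -/(y t).
  move: (F (y t)) (F x) ('d F x d : R) ('d F x w : R) => a1 a2 a3 a4.
  by field; rewrite gt_eqF.
apply: (@penalized_limit _ (0 : R)^'+ _ y (fun t => 2^-1 * (t * t)) id) => //.
- by near=> t; rewrite mulr_gt0// mulr_gt0//; near: t.
- by near=> t; rewrite ltW//; near: t.
- have [[A B]/= [A0 B0] AB] := pen_fc.
  by near=> t; apply: (AB (t, v t)); split => /=; near: t; [|exact: vd].
- exact: quot.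
- move=> j; have := quot _ (C2c j); rewrite cx cd.
  by under eq_fun do rewrite mulr0 !subr0.
Unshelve. all: by end_near. Qed.

Hypothesis k0 : 0 <= k.

Lemma affine_diff (F : X -> R) (C : R) : affine_fct (fun w => 'd F x w + C).
Proof.
move=> v w t; rewrite linearD !(linearZZ ('d F x)) /GRing.scale/=.
by move: ('d F x v : R) ('d F x w : R) => a1 a2; ring.
Qed.

(** Replacing the penalty terms by multipliers leaves an affine function of [w]
    that is bounded below; so its linear part vanishes, which is stationarity,
    and its constant part is nonnegative. *)
Lemma pen_bound_multiplier (a : R) (b : J -> R) :
  (forall w, 0 <= ('d f x w + a) + k * \sum_j pen (eqn j) ('d (c j) x w + b j)) ->
  exists mu : J -> R, [/\ forall j, ~~ eqn j -> 0 <= mu j,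
    forall w, 'd (affine_comb mu f c) x w = 0 & 0 <= a + \sum_j mu j * b j].
Proof.
move=> h.
have [mu mu0 hmu] := sum_pen_multiplier k0 (affine_convex (affine_diff f a))
  (fun j => affine_diff (c j) (b j)) h.
have [|C0 l0] := @linear_bounded_below ('d (affine_comb mu f c) x)
  (a + \sum_j mu j * b j); last by exists mu.
move=> w; have := hmu w; rewrite diff_affine_comb//.
under eq_bigr do rewrite mulrDr.
by rewrite big_split/= addrACA.
Qed.

(** With [a] and [b] the second derivatives along [d], the constant part is the
    curvature of the Lagrangian; without second derivatives they are taken to be
    [0]. *)
Lemma penalized_multiplier :
  exists mu : J -> R, [/\ forall j, ~~ eqn j -> 0 <= mu j,
    forall w, 'd (affine_comb mu f c) x w = 0 &
    C2 f -> (forall j, C2 (c j)) -> 0 <= curv (affine_comb mu f c) x d].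
Proof.
have [[C2f C2c]|nC2] := pselect (C2 f /\ forall j, C2 (c j)).
  have [mu [mu0 dmu cmu]] := @pen_bound_multiplier (curv f x d)
    (fun j => curv (c j) x d) (fun w => penalized_second_order w C2f C2c).
  by exists mu; split => // _ _; rewrite curv_affine_comb.
have [|mu [mu0 dmu _]] := @pen_bound_multiplier 0 (fun=> 0).
  move=> w; rewrite addr0; under eq_bigr do rewrite addr0.
  exact: penalized_first_order.
by exists mu; split => // C2f C2c; case: nC2.
Qed.

End Penalized.

(** * Linear independence of gradients implies exact penalization *)

Section Regularity.
Context {R : realType} {n : nat}.
Local Notation X := 'rV[R]_n.
Implicit Types (d u v w y z : X).

Lemma C1_lipschitz (F : X -> R) x : C1 F -> exists2 L : R, 0 <= L &
  exists2 eta : R, 0 < eta & forall y z, `|y - x| < eta -> `|z - x| < eta ->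
    `|F z - F y| <= L * `|z - y|.
Proof.
move=> CF; have [eta eta0 heta] := C1_strict_diff x CF ltr01.
have cd : continuous ('d F x : X -> R).
  by apply: diff_continuous; case: CF.
have [K K0 hK] := linear_lipschitz cd.
exists (K + 1); first by rewrite addr_ge0// ltW.
exists eta => // y z yx zx; have h1 := heta y z yx zx; have h2 := hK (z - y).
rewrite -(subrK ('d F x (z - y) : R) (F z - F y)).
apply: le_trans (ler_normD _ _) _; rewrite mulrDl addrC; exact: lerD.
Qed.

Variables (J : finType) (c : J -> X -> R) (x : X).
Hypothesis (Cc : forall j, C1 (c j)).
Hypothesis indep : forall nu : J -> R,
  (forall w, \sum_j nu j * 'd (c j) x w = 0) -> forall j, nu j = 0.

Lemma gradient_dual_basis :
  exists b : J -> X, forall j k, 'd (c k) x (b j) = (k == j)%:R :> R.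
Proof.
pose A := \matrix_(i < #|J|) grad (c (enum_val i)) x.
have dc j : differentiable (c j) x by case: (Cc j).
have freeA : row_free A.
  apply: inj_row_free => v vA; apply/rowP => i; rewrite mxE.
  have := @indep (fun j => v 0 (enum_rank j)) _ (enum_val i).
  rewrite enum_valK; apply => w.
  transitivity (dotp (v *m A) w); last by rewrite vA dotpE mul0mx mxE.
  rewrite mulmx_sum_row dotp_suml (reindex (@enum_val J predT))/=; last first.
    by apply: onW_bij; exact: enum_val_bij.
  by apply: eq_bigr => k _; rewrite enum_valK rowK dotpZl grad_dotp.
exists (fun j => (col (enum_rank j) (pinvmx A))^T) => j k.
have := congr1 (fun B : 'M[R]_(#|J|, #|J|) => B (enum_rank k) (enum_rank j))
  (mulmxVp freeA).
rewrite !mxE (inj_eq enum_rank_inj) => <-.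
by rewrite grad_dotp//; apply: eq_bigr => i _; rewrite !mxE enum_rankK.
Qed.

Lemma uniform_strict_diff (e : R) : 0 < e -> exists2 r : R, 0 < r &
  forall j y z, `|y - x| < r -> `|z - x| < r ->
    `|c j z - c j y - 'd (c j) x (z - y)| <= e * `|z - y|.
Proof.
move=> e0.
have h j : \forall r \near (0 : R)^'+, 0 < r /\
    forall y z, `|y - x| < r -> `|z - x| < r ->
    `|c j z - c j y - 'd (c j) x (z - y)| <= e * `|z - y|.
  have [eta eta0 heta] := C1_strict_diff x (Cc j) e0.
  near=> r; split=> [|y z yx zx]; first by near: r; exact: nbhs_right_gt.
  have reta : r <= eta by near: r; exact: nbhs_right_le.
  by apply: heta; exact: lt_le_trans reta.
have r0 : \forall r \near (0 : R)^'+, 0 < r by exact: nbhs_right_gt.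
have [r [rpos hr]] := filter_ex (filterI r0 (filter_forall _ h)).
by exists r => // j; have [] := hr j.
Unshelve. all: by end_near. Qed.

Lemma closed_ball0_compact (rho : R) : compact [set u : X | `|u| <= rho].
Proof.
apply: bounded_closed_compact.
  exists rho; split; first exact: num_real.
  by move=> M rM u /= urho; exact: le_trans urho (ltW rM).
have -> : [set u : X | `|u| <= rho] = closed_ball_ Num.norm 0 rho.
  by apply/seteqP; split => u /=; rewrite /closed_ball_/= sub0r normrN.
exact: closed_closed_ball_.
Qed.

Lemma residual_continuous x' (tau : J -> R) (theta : R) :
  continuous (fun u => \sum_j `|c j (x' + u) - tau j| + theta * `|u|).
Proof.
have hc j : continuous (fun u => `|c j (x' + u) - tau j|).
  move=> u; have cj : {for x' + u, continuous (c j)}.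
    by apply: differentiable_continuous; case: (Cc j).
  have sh : (fun u : X => x' + u) @ u --> x' + u.
    exact: (cvgD (cvg_cst _) cvg_id).
  exact: (cvg_norm (cvgB (cvg_comp _ _ sh cj) (cvg_cst _))).
move=> u; apply: (cvgD (cvg_sumr (fun j => hc j u))).
exact: (cvgM (cvg_cst _) (@norm_continuous _ _ u)).
Qed.

(** Minimizing the residual plus a small multiple of the displacement over a
    closed ball gives an exact solution: at a point of positive residual the
    step [- s * residual] along the dual basis decreases the residual at a rate
    of at least [3 / 4], which beats the growth of the displacement term. *)
Lemma metric_regularity : exists2 C : R, 0 <= C & exists2 eta : R, 0 < eta &
  forall x' (tau : J -> R), `|x' - x| < eta ->
    \sum_j `|c j x' - tau j| < eta ->
    exists2 u, `|u| <= C * \sum_j `|c j x' - tau j| &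
      forall j, c j (x' + u) = tau j.
Proof.
have [b hb] := gradient_dual_basis.
pose M := \sum_j `|b j|; have M0 : 0 <= M by apply: sumr_ge0.
(* with these two constants the displacement term and the linearization error
   each consume at most a quarter of the decrease [s * E] of the residual *)
pose theta : R := (4 * (M + 1))^-1.
have th0 : 0 < theta by rewrite invr_gt0 mulr_gt0// ltr_wpDl.
pose K : R := #|J|%:R.
have K0 : 0 <= K by rewrite ler0n.
pose e : R := (4 * ((K + 1) * (M + 1)))^-1.
have e0 : 0 < e by rewrite invr_gt0 !mulr_gt0// ltr_wpDl.
have [r r0 hr] := uniform_strict_diff e0.
have quarter : r / 4 + r / 2 <= r by lra.
pose rho := r / 2; have rho0 : 0 < rho by rewrite divr_gt0.
exists theta^-1; first by rewrite invr_ge0 ltW.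
exists (Num.min (r / 4) (theta * rho)).
  by rewrite lt_min divr_gt0// mulr_gt0.
move=> x' tau; rewrite !lt_min => /andP[x'x _] /andP[_ Erho].
pose res u := \sum_j `|c j (x' + u) - tau j|.
have res_ge0 u : 0 <= res u by apply: sumr_ge0.
have E0 : \sum_j `|c j x' - tau j| = res 0.
  by apply: eq_bigr => j _; rewrite addr0.
rewrite E0 in Erho *.
pose psi u := res u + theta * `|u|.
have [ub /set_mem/= ubA umin] : exists2 u, u \in [set u : X | `|u| <= rho] &
    forall w, w \in [set u : X | `|u| <= rho] -> psi u <= psi w.
  apply: EVT_min_rV; first by exists 0; rewrite /= normr0 ltW.
    exact: closed_ball0_compact.
  apply: continuous_subspaceT; exact: residual_continuous.
have psi0 : psi ub <= res 0.
  have := umin 0; rewrite inE/= normr0 ltW// => /(_ isT).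
  by rewrite [psi 0]/psi normr0 mulr0 addr0.
have ub_le : theta * `|ub| <= res 0.
  by apply: le_trans psi0; rewrite lerDr.
have ub_lt : `|ub| < rho.
  by rewrite -(ltr_pM2l th0); exact: le_lt_trans Erho.
exists ub; first by rewrite ler_pdivlMl.
suff resub : res ub = 0.
  move=> j; apply/eqP; rewrite -subr_eq0 -normr_eq0 eq_le normr_ge0 andbT.
  by rewrite -resub /res (bigD1 j)//= lerDl sumr_ge0.
apply/eqP; rewrite eq_le res_ge0 andbT leNgt; apply/negP => E_gt0.
set E := res ub in E_gt0 psi0.
pose ej j := c j (x' + ub) - tau j.
pose p := - \sum_j ej j *: b j.
have pE : `|p| <= M * E.
  rewrite normrN /M mulr_suml; apply: le_trans (ler_norm_sum _ _ _) _.
  apply: ler_sum => j _; rewrite normrZ mulrC; apply: ler_wpM2l => //.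
  by rewrite /E /res (bigD1 j)//= lerDl sumr_ge0.
have dp k : 'd (c k) x p = - ej k :> R.
  rewrite linearN linear_sum (bigD1 k)//= (linearZZ ('d (c k) x)).
  rewrite /GRing.scale/= hb eqxx mulr1 big1 ?addr0// => j jk.
  by rewrite (linearZZ ('d (c k) x)) /GRing.scale/= hb eq_sym (negbTE jk) mulr0.
have gap : 0 < rho - `|ub| by rewrite subr_gt0.
have ME1 : 0 < M * E + 1 by rewrite ltr_wpDl// mulr_ge0// ltW.
pose s := Num.min 1 ((rho - `|ub|) / (M * E + 1)).
have s0 : 0 < s by rewrite lt_min ltr01 divr_gt0.
have s1 : s <= 1 by rewrite ge_min lexx.
have sp : `|s *: p| <= s * (M * E).
  by rewrite normrZ gtr0_norm// ler_wpM2l// ltW.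
have up : `|ub + s *: p| <= rho.
  apply: le_trans (ler_normD _ _) _; rewrite -lerBrDl; apply: le_trans sp _.
  apply: le_trans (_ : s * (M * E + 1) <= _).
    by rewrite ler_wpM2l ?ltW// ltrDl.
  by rewrite -ler_pdivlMr// ge_min lexx orbT.
have near1 u : `|u| <= rho -> `|x' + u - x| < r.
  move=> urho; rewrite addrAC; apply: le_lt_trans (ler_normD _ _) _.
  apply: lt_le_trans (ltr_leD x'x urho) _.
  exact: quarter.
have step k : `|c k (x' + (ub + s *: p)) - tau k| <=
    (1 - s) * `|ej k| + e * (s * (M * E)).
  have := hr k _ _ (near1 _ ubA) (near1 _ up).
  have -> : x' + (ub + s *: p) - (x' + ub) = s *: p.
    by apply/rowP => i; rewrite !mxE; ring.
  rewrite (linearZZ ('d (c k) x)) /GRing.scale/= dp => h.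
  have -> : c k (x' + (ub + s *: p)) - tau k = (1 - s) * ej k +
      (c k (x' + (ub + s *: p)) - c k (x' + ub) - s * - ej k).
    by rewrite /ej; move: (c k _) (c k _) (tau k) => a1 a2 a3; ring.
  apply: le_trans (ler_normD _ _) _; apply: lerD.
    by rewrite normrM ger0_norm// subr_ge0.
  by apply: le_trans h _; rewrite ler_wpM2l// ltW.
have res_step : res (ub + s *: p) <= (1 - s) * E + K * (e * (s * (M * E))).
  apply: le_trans (ler_sum _ (fun k _ => step k)) _.
  by rewrite big_split/= -mulr_sumr sumr_const -[X in _ + X]mulr_natl.
have := umin (ub + s *: p); rewrite inE/= => /(_ up); apply/negP; rewrite -ltNge.
rewrite /psi -/E; have nstep := ler_normD ub (s *: p).
have h1 : theta * `|ub + s *: p| <= theta * `|ub| + theta * (s * (M * E)).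
  rewrite -mulrDr ler_wpM2l ?(ltW th0)//.
  by apply: le_trans nstep _; rewrite lerD2l.
have sE : 0 < s * E by rewrite mulr_gt0.
have sE4 : 0 <= s * E / 4 by rewrite divr_ge0// ltW.
have frac (q : R) : 0 <= q -> 0 <= q / (q + 1) <= 1.
  move=> q0; have q1 : 0 < q + 1 by rewrite ltr_wpDl.
  by rewrite divr_ge0 ?(ltW q1)//= ler_pdivrMr// mul1r lerDl.
have /andP[fM0 fM1] := frac _ M0; have /andP[fK0 fK1] := frac _ K0.
have h2 : theta * (s * (M * E)) <= s * E / 4.
  have -> : theta * (s * (M * E)) = s * E / 4 * (M / (M + 1)).
    by rewrite /theta; field; rewrite gt_eqF// ltr_wpDl.
  exact: ler_piMr.
have h3 : K * (e * (s * (M * E))) <= s * E / 4.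
  have -> : K * (e * (s * (M * E))) = s * E / 4 * (K / (K + 1) * (M / (M + 1))).
    by rewrite /e; field; rewrite !gt_eqF// ltr_wpDl.
  by apply: ler_piMr => //; exact: mulr_ile1.
apply: le_lt_trans (lerD res_step h1) _.
have alg (q1 q2 q3 q4 q5 : R) : q3 <= q4 / 4 -> q2 <= q4 / 4 -> 0 < q4 ->
    q5 - q4 + q2 + (q1 + q3) < q5 + q1 by lra.
by rewrite mulrBl mul1r; exact: alg.
Qed.

Definition nearest_admissible (b : bool) (a : R) : R :=
  if b then 0 else Num.min a 0.

Lemma pen_nearest b (a : R) : `|a - nearest_admissible b a| = pen b a.
Proof.
rewrite /pen /nearest_admissible; case: b; first by rewrite subr0.
have [a0|a0] := leP a 0; first by rewrite subrr normr0.
by rewrite subr0 gtr0_norm.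
Qed.

Definition admissible (b : bool) (a : R) : Prop := if b then a = 0 else a <= 0.

Lemma nearest_is_admissible b (a : R) : admissible b (nearest_admissible b a).
Proof.
by rewrite /nearest_admissible; case: b => //=; rewrite ge_min lexx orbT.
Qed.

(** The constraints vanish at [x] to first order in the direction [d]. *)
Lemma pen_sum_small (eqn : pred J) d :
  (forall j, c j x = 0) -> (forall j, 'd (c j) x d = 0) -> forall e : R, 0 < e ->
  \forall p \near dirf R d,
    \sum_j pen (eqn j) (c j (x + p.1 *: p.2)) < p.1 * e.
Proof.
move=> cx cd e e0.
have hS : (fun p : R * X => \sum_j pen (eqn j) (p.1^-1 * c j (x + p.1 *: p.2)))
    @ dirf R d --> \sum_(j : J) (0 : R).
  apply: (cvg_sumr (u := fun j (p : R * X) =>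
    pen (eqn j) (p.1^-1 * c j (x + p.1 *: p.2)))) => j.
  rewrite -[X in _ --> X](pen0 (eqn j)); apply: pen_cvg.
  have h : (fun p : R * X => p.1^-1 * (c j (x + p.1 *: p.2) - c j x)) @ dirf R d -->
      'd (c j) x d by apply: dirf_quotient; have [dc _] := Cc j; exact: dc.
  by rewrite cd in h; under eq_fun do rewrite -[c j _]subr0 -(cx j).
rewrite big1// in hS; near=> p.
have p0 : 0 < p.1 by near: p; exact: dirf_pos.
have : \sum_j pen (eqn j) (p.1^-1 * c j (x + p.1 *: p.2)) < e.
  by near: p; apply: (cvgr_lt _ hS).
under eq_bigr => j _ do rewrite penM ?invr_ge0 ?(ltW p0)//.
by rewrite -mulr_sumr ltr_pdivrMl.
Unshelve. all: by end_near. Qed.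

(** Correcting [x + t v] to an admissible point costs [o(t)], because the
    constraints and their derivatives along [d] vanish; the corrected point is
    therefore still of the form [x + t v'] with [v'] close to [d], which is
    where [f] is known to be minimal. *)
Lemma indep_penalized (eqn : pred J) (f : X -> R) d :
  C1 f -> (forall j, c j x = 0) -> (forall j, 'd (c j) x d = 0) ->
  (\forall p \near dirf R d,
     (forall j, admissible (eqn j) (c j (x + p.1 *: p.2))) ->
     f x <= f (x + p.1 *: p.2)) ->
  exists2 k : R, 0 <= k & penalized eqn f c x d k.
Proof.
move=> Cf cx cd hmin.
pose S (p : R * X) := \sum_j pen (eqn j) (c j (x + p.1 *: p.2)).
have [C C0 [eta eta0 hC]] := metric_regularity.
have [L L0 [etaL etaL0 hL]] := C1_lipschitz x Cf.
have [[A B]/= [A0 /near_distP[r r0 rB]] AB] := hmin.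
exists (L * C); first exact: mulr_ge0.
have C1 : 0 < C + 1 by rewrite ltr_wpDl.
pose D := `|d| + r.
have D0 : 0 < D by rewrite ltr_wpDl.
near=> p.
have p0 : 0 < p.1 by near: p; exact: dirf_pos.
have pA : A p.1 by near: p; exact: (@dirf_fst R n d A A0).
have pd : `|p.2 - d| < r / 2.
  by near: p; apply: dirf_dist; rewrite divr_gt0.
have peta : p.1 * D < eta.
  by rewrite -ltr_pdivlMr//; near: p; apply: dirf_lt; rewrite divr_gt0.
have petaL : p.1 * D < etaL.
  by rewrite -ltr_pdivlMr//; near: p; apply: dirf_lt; rewrite divr_gt0.
have Sp : S p < p.1 * (r / (2 * (C + 1))).
  by near: p; apply: pen_sum_small => //; rewrite divr_gt0// mulr_gt0.
have Seta : S p < eta.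
  apply: lt_trans (_ : p.1 * 1 < _); first by near: p; exact: pen_sum_small.
  by rewrite mulr1; near: p; exact: dirf_lt.
pose y := x + p.1 *: p.2.
have near_x (v : X) : `|v - d| < r -> `|x + p.1 *: v - x| < p.1 * D.
  move=> vdr; rewrite addrC addKr normrZ (gtr0_norm p0) ltr_pM2l//.
  rewrite -(subrK d v) addrC; apply: le_lt_trans (ler_normD _ _) _.
  by rewrite /D ltrD2l.
have pdr : `|p.2 - d| < r.
  by apply: lt_trans pd _; rewrite ltr_pdivrMr// ltr_pMr// ltr1n.
have yx : `|y - x| < p.1 * D by exact: near_x.
have SE : \sum_j `|c j y - nearest_admissible (eqn j) (c j y)| = S p.
  by apply: eq_bigr => j _; rewrite pen_nearest.
have [||u uS hu] := hC y (fun j => nearest_admissible (eqn j) (c j y)).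
- exact: lt_trans yx _.
- by rewrite SE.
rewrite SE in uS; pose v := p.2 + p.1^-1 *: u.
have yu : x + p.1 *: v = y + u.
  by rewrite /v scalerDr scalerA mulfV ?gt_eqF// scale1r addrA.
have vdr : `|v - d| < r.
  rewrite /v addrAC; apply: le_lt_trans (ler_normD _ _) _.
  rewrite [ltRHS](splitr r); apply: ltr_leD => //.
  rewrite normrZ gtr0_norm ?invr_gt0// ler_pdivrMl//.
  apply: le_trans uS _; apply: le_trans (ler_wpM2l C0 (ltW Sp)) _.
  have -> : C * (p.1 * (r / (2 * (C + 1)))) = p.1 * (r / 2) * (C / (C + 1)).
    by field; rewrite gt_eqF.
  apply: ler_piMr; first by rewrite mulr_ge0// ?divr_ge0// ltW.
  by rewrite ler_pdivrMr// mul1r lerDl.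
have fyu : f x <= f (y + u).
  rewrite -yu; apply: (AB (p.1, v)); first by split => //=; exact: rB.
  by move=> j /=; rewrite yu hu; exact: nearest_is_admissible.
have yux : `|y + u - x| < etaL by rewrite -yu; exact: lt_trans (near_x _ vdr) _.
have := hL y (y + u) (lt_trans yx petaL) yux.
rewrite [y + u - y]addrC addKr => hLu.
apply: le_trans fyu _; rewrite -lerBlDl; apply: le_trans (ler_norm _) _.
by apply: le_trans hLu _; rewrite -mulrA; apply: ler_wpM2l.
Unshelve. all: by end_near. Qed.

End Regularity.
(** * Finite unions of subspaces *)

Section Subspaces.
Context {R : realType} {q : nat}.
Local Notation Y := 'rV[R]_q.
Implicit Types (U V : {vspace Y}) (u v w y z : Y).

Lemma dotpBr u v w : dotp u (v - w) = dotp u v - dotp u w.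
Proof. by rewrite dotpDr -scaleN1r dotpZr mulN1r. Qed.

Lemma enorm_ge0 u : 0 <= enorm u. Proof. exact: sqrtr_ge0. Qed.

Lemma enorm_le_l1 u : enorm u <= \sum_i `|u 0 i|.
Proof.
have s0 : 0 <= \sum_i `|u 0 i| by apply: sumr_ge0.
rewrite -[leRHS]ger0_norm// -sqrtr_sqr; apply: ler_wsqrtr.
rewrite expr2 mulr_suml; apply: ler_sum => i _.
apply: le_trans (ler_norm _) _; rewrite normrM; apply: ler_wpM2l => //.
by rewrite (bigD1 i)//= lerDl sumr_ge0.
Qed.

Lemma coord_le_enorm u i : `|u 0 i| <= enorm u.
Proof.
rewrite -sqrtr_sqr; apply: ler_wsqrtr; rewrite /dotp (bigD1 i)//= expr2 lerDl.
by apply: sumr_ge0 => j _; rewrite -expr2 sqr_ge0.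
Qed.

Lemma norm_le_enorm u : `|u| <= enorm u.
Proof.
rewrite [leLHS]/Num.norm /= mx_normrE; apply/bigmax_leP; split.
  exact: enorm_ge0.
by move=> [i j] _ /=; rewrite ord1; exact: coord_le_enorm.
Qed.

Lemma enormZ t u : 0 <= t -> enorm (t *: u) = t * enorm u.
Proof.
move=> t0; rewrite /enorm dotpZl dotpZr mulrA -expr2 sqrtrM ?sqr_ge0//.
by rewrite sqrtr_sqr ger0_norm.
Qed.

Lemma enorm_eq0 u : (enorm u == 0) = (u == 0).
Proof.
apply/eqP/eqP => [u0|->]; last by rewrite -(scale0r 0) enormZ// mul0r.
by apply/eqP; rewrite -normr_le0 -u0 norm_le_enorm.
Qed.

(** The equations are chosen independent, so that multipliers of the equations
    and vectors of the orthogonal complement correspond one to one. *)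
Lemma subspace_equations U : exists k (D : 'M[R]_(k, q)), row_free D /\
  forall y, (y \in U) <-> forall j, dotp (row j D) y = 0.
Proof.
pose M : 'M[R]_(\dim U, q) := \matrix_i (vbasis U)`_i.
have inU y : (y \in U) = (y *m cokermx M == 0).
  rewrite -submxE; apply/idP/submxP => [yU|[w ->]].
    exists (\row_i coord (vbasis U) i y).
    rewrite {1}(coord_vbasis yU) mulmx_sum_row; apply: eq_bigr => i _.
    by rewrite mxE rowK.
  rewrite mulmx_sum_row; apply: memv_suml => i _; rewrite rowK memvZ//.
  by rewrite vbasis_mem// mem_nth// size_tuple.
pose A := (cokermx M)^T; exists (\rank A), (row_base A).
split=> [|y]; first exact: row_base_free.
have /submxP[E1 h1] : (row_base A <= A)%MS by rewrite eq_row_base.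
have /submxP[E2 h2] : (A <= row_base A)%MS by rewrite eq_row_base.
rewrite inU -(inj_eq trmx_inj) trmx_mul trmx0 -/A; split.
  move=> /eqP Ay j; have : row_base A *m y^T = 0 by rewrite h1 -mulmxA Ay mulmx0.
  by move=> /(congr1 (row j)); rewrite row_mul => h; rewrite dotpE h !mxE.
move=> h; suff D0 : row_base A *m y^T = 0 by rewrite h2 -mulmxA D0 mulmx0.
by apply/row_matrixP => j; rewrite row_mul row0; apply/rowP => i;
   rewrite ord1 -dotpE h mxE.
Qed.

Lemma subspace_near U y : y \notin U -> \forall z \near y, z \notin U.
Proof.
move=> yU; have [k [D [_ inU]]] := subspace_equations U.
have [j hj] : exists j, dotp (row j D) y != 0.
  apply/existsP; apply: contraNT yU => /existsPn h; apply/inU => j.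
  by apply/eqP; have := h j; rewrite negbK.
have : \forall z \near y, dotp (row j D) z != 0.
  exact: (cvgr_neq0 _ (@dotp_continuous R q (row j D) y) hj).
by apply: filterS => z; apply: contraNN => /inU ->.
Qed.

(** A right inverse of [D] turns the defect [D *m y^T] into a correction of [y]. *)
Lemma subspace_error_bound U k (D : 'M[R]_(k, q)) : row_free D ->
  (forall y, (y \in U) <-> forall j, dotp (row j D) y = 0) ->
  exists2 C : R, 0 <= C & forall y, exists2 z, z \in U &
    enorm (y - z) <= C * \sum_j `|dotp (row j D) y|.
Proof.
move=> freeD inU; pose E := pinvmx D.
exists (\sum_i \sum_j `|E i j|); first by apply: sumr_ge0 => i _; apply: sumr_ge0.
move=> y; pose a := D *m y^T.
have aE j : a j 0 = dotp (row j D) y.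
  by rewrite dotpE -row_mul [RHS]mxE.
exists (y - (E *m a)^T).
  apply/inU => j; rewrite dotpBr -!aE /a.
  rewrite dotpE trmxK -row_mul mulmxA mulmxVp// mul1mx.
  by rewrite [X in _ - X]mxE subrr.
rewrite subKr; apply: le_trans (enorm_le_l1 _) _.
rewrite mulr_suml; apply: ler_sum => i _; rewrite !mxE mulr_suml.
apply: le_trans (ler_norm_sum _ _ _) _; apply: ler_sum => j _.
rewrite normrM aE; apply: ler_wpM2l => //.
by rewrite (bigD1 j)//= lerDl sumr_ge0.
Qed.

Lemma near_dist_lt y (e : R) : 0 < e -> \forall z \near y, `|z - y| < e.
Proof. by move=> e0; apply/near_distP; exists e. Qed.

(** A subspace is not covered by finitely many subspaces not containing it, even
    locally: leaving one more of them by a small step does not re-enter those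
    already left, since these are closed. *)
Lemma generic_point (I : finType) (V_ : I -> {vspace Y}) (s : seq I) U z (e : R) :
  z \in U -> 0 < e -> exists2 z', z' \in U &
    `|z' - z| < e /\ forall i, i \in s -> ~~ (U <= V_ i)%VS -> z' \notin V_ i.
Proof.
move=> zU; elim: s e => [e e0|i s IH e e0].
  by exists z => //; rewrite subrr normr0.
have [|z1 z1U [z1z hz1]] := IH (e / 2); first by rewrite divr_gt0.
have e2e : e / 2 < e by rewrite ltr_pdivrMr// ltr_pMr// ltr1n.
have [Ui|/subvPn[w wU wi]] := boolP (U <= V_ i)%VS.
  exists z1 => //; split; first exact: lt_trans e2e.
  by move=> j; rewrite inE => /orP[/eqP ->|/hz1//]; rewrite Ui.
have [z1i|z1i] := boolP (z1 \in V_ i); last first.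
  exists z1 => //; split; first exact: lt_trans e2e.
  by move=> j; rewrite inE => /orP[/eqP ->|/hz1//].
have stay j : \forall z' \near z1,
    j \in s -> ~~ (U <= V_ j)%VS -> z' \notin V_ j.
  have [/andP[js Uj]|] := boolP ((j \in s) && ~~ (U <= V_ j)%VS).
    by apply: filterS (subspace_near (hz1 j js Uj)) => z'.
  by move=> h; near=> z' => js Uj; rewrite js Uj in h.
have step : (fun t : R => z1 + t *: w) @ (0 : R)^'+ --> z1.
  have h : (fun t : R => z1 + t *: w) @ (0 : R)^'+ --> z1 + 0 *: w.
    apply: (cvgD (cvg_cst _)); apply: cvgZ (cvg_cst _).
    by apply: cvg_within_filter; exact: cvg_id.
  by rewrite scale0r addr0 in h.
have e20 : 0 < e / 2 by rewrite divr_gt0.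
have [t [t0 [ts te]]] := filter_ex (filterI (nbhs_right_gt (0 : R))
  (filterI (step _ (filter_forall _ stay)) (step _ (near_dist_lt z1 e20)))).
exists (z1 + t *: w); first by rewrite memvD// memvZ.
split.
  rewrite -(subrK z1 (z1 + t *: w)) -addrA; apply: le_lt_trans (ler_normD _ _) _.
  by rewrite [ltRHS](splitr e); exact: ltrD.
move=> j; rewrite inE => /orP[/eqP -> _|js]; last exact: ts.
by rewrite rpredDl// rpredZeq negb_or gt_eqF.
Unshelve. all: by end_near. Qed.

End Subspaces.

Section UnionOfSubspaces.
Context {R : realType} {n m p l q N : nat}.
Variable P : mpdsc R n m p l q N.
Local Notation Y := 'rV[R]_q.
Local Notation S_ := (subsp P).
Local Notation S := (Sset P).
Implicit Types (v w y z : Y) (r : 'I_N).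

(** Subspaces are closed, and there are finitely many of them. *)
Lemma near_subspaces y : \forall z \near y, forall r, z \in S_ r -> y \in S_ r.
Proof.
have h r : \forall z \near y, z \in S_ r -> y \in S_ r.
  have [yr|yr] := boolP (y \in S_ r); first by near=> z.
  by apply: filterS (subspace_near yr) => z /negP zr /zr.
exact: (filter_forall _ h).
Unshelve. all: by end_near. Qed.

Lemma harmonic_pos (j : nat) : 0 < j.+1%:R^-1 :> R.
Proof. by rewrite invr_gt0 ltr0n. Qed.

(** The points approximating [y] eventually lie in subspaces that contain [y]; so
    do their directions, and by closedness the limit direction. *)
Lemma tangent_coneP y w :
  tangent_cone S y w <-> exists2 r, y \in S_ r & w \in S_ r.
Proof.
split=> [[t_ [w_ [t0 tcvg wcvg inS]]]|[r yr wr]].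
  have ycvg : (fun j => y + t_ j *: w_ j) @ \oo --> y.
    have h : (fun j => y + t_ j *: w_ j) @ \oo --> y + 0 *: w.
      by apply: (cvgD (cvg_cst _)); exact: cvgZ.
    by rewrite scale0r addr0 in h.
  have hy : \forall j \near \oo, forall r, y + t_ j *: w_ j \in S_ r -> y \in S_ r.
    exact: (ycvg _ (near_subspaces y)).
  have hw : \forall j \near \oo, forall r, w_ j \in S_ r -> w \in S_ r.
    exact: (wcvg _ (near_subspaces w)).
  have [j [{}hy {}hw]] := filter_ex (filterI hy hw).
  have [r yr] := inS j; have {}hy := hy _ yr; exists r => //; apply: hw.
  by move: yr; rewrite rpredDl// rpredZeq gt_eqF.
exists (fun j => j.+1%:R^-1), (fun=> w); split.
- exact: harmonic_pos.
- exact: cvg_harmonic.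
- exact: cvg_cst.
- by move=> j; exists r; rewrite memvD// memvZ.
Qed.

(** A subspace that is maximal for inclusion is, near each of its generic points, the
    whole union: there the Frechet normal cone is its orthogonal complement. *)
Lemma orth_sub_dir_normal y w r v :
  y \in S_ r -> w \in S_ r ->
  (forall r', (S_ r <= S_ r')%VS -> (S_ r' <= S_ r)%VS) ->
  orth (S_ r) v -> dir_normal S y w v.
Proof.
move=> yr wr maxr vr; split; first by exists r.
have gen j : exists w' : Y, [/\ w' \in S_ r, `|w' - w| < j.+1%:R^-1 &
    forall r', ~~ (S_ r <= S_ r')%VS -> y + j.+1%:R^-1 *: w' \notin S_ r'].
  have tj := harmonic_pos j; set t := j.+1%:R^-1 in tj *.
  have zr : y + t *: w \in S_ r by rewrite memvD// memvZ.
  have [z' z'r [z'z hz']] := generic_point S_ (enum 'I_N) zr (mulr_gt0 tj tj).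
  exists (t^-1 *: (z' - y)); split.
  - by rewrite memvZ// memvB.
  - have -> : t^-1 *: (z' - y) - w = t^-1 *: (z' - (y + t *: w)).
      by rewrite opprD addrA [RHS]scalerBr scalerA mulVf ?scale1r// gt_eqF.
    by rewrite normrZ gtr0_norm ?invr_gt0// ltr_pdivrMl.
  - move=> r' rr'; rewrite scalerA mulfV ?gt_eqF// scale1r addrC subrK.
    by apply: hz' => //; rewrite mem_enum.
have [w_ hw] := choice gen.
exists (fun j => j.+1%:R^-1), w_, (fun=> v); split.
- exact: harmonic_pos.
- exact: cvg_harmonic.
- apply/cvgrPdist_lt => e e0.
  have /cvgrPdist_lt/(_ _ e0) : (fun j => j.+1%:R^-1 : R) @ \oo --> (0 : R).
    exact: cvg_harmonic.
  apply: filterS => j; rewrite sub0r normrN gtr0_norm ?harmonic_pos// => je.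
  by rewrite distrC; have [_ wj _] := hw j; exact: lt_trans je.
- exact: cvg_cst.
move=> j; have [wjr _ gj] := hw j; set z := y + _ *: w_ j.
have zr : z \in S_ r by rewrite memvD// memvZ.
split; first by exists r.
move=> e e0; rewrite near_withinE; near=> z' => -[r' z'r'].
have zr' : z \in S_ r' by move: r' z'r'; near: z'; exact: near_subspaces.
have rr' : (S_ r <= S_ r')%VS.
  by apply/negPn/negP => /gj; rewrite -/z zr'.
rewrite vr ?mulr_ge0 ?enorm_ge0 ?(ltW e0)// memvB//.
exact: (subvP (maxr _ rr')).
Unshelve. all: by end_near. Qed.

(** A vector of such a subspace and its opposite can both be added to [w] in
    arbitrarily small multiples without leaving the tangent cone, so a normal
    vector is orthogonal to it.  Conversely, close to [w] the cone consists of
    the subspaces that contain [w]. *)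
Lemma tangent_normalP y w v :
  (exists2 r, y \in S_ r & w \in S_ r) ->
  frechet_normal (tangent_cone S y) w v <->
  forall r, y \in S_ r -> w \in S_ r -> orth (S_ r) v.
Proof.
move=> yw; split=> [[_ vn] r yr wr u ur|vr].
  have le0 u' : u' \in S_ r -> dotp v u' <= 0.
    move=> u'r; rewrite leNgt; apply/negP => vu'.
    have c0 : 0 < enorm u' + 1 by rewrite ltr_wpDl// enorm_ge0.
    have e0 : 0 < dotp v u' / (enorm u' + 1) by rewrite divr_gt0.
    have step : (fun s : R => w + s *: u') @ (0 : R)^'+ --> w.
      have h : (fun s : R => w + s *: u') @ (0 : R)^'+ --> w + 0 *: u'.
        apply: (cvgD (cvg_cst _)); apply: cvgZ (cvg_cst _).
        by apply: cvg_within_filter; exact: cvg_id.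
      by rewrite scale0r addr0 in h.
    have vs : \forall s \near (0 : R)^'+, tangent_cone S y (w + s *: u') ->
        dotp v (w + s *: u' - w) <=
        dotp v u' / (enorm u' + 1) * enorm (w + s *: u' - w).
      exact: (step _ (vn _ e0)).
    have [s [s0 hs]] := filter_ex (filterI (nbhs_right_gt (0 : R)) vs).
    have inT : tangent_cone S y (w + s *: u').
      by apply/tangent_coneP; exists r => //; rewrite memvD// memvZ.
    have := hs inT; rewrite addrC addKr enormZ ?(ltW s0)// dotpZr mulrCA.
    rewrite ler_pM2l// mulrAC ler_pdivlMr// leNgt.
    by rewrite ltr_pM2l// ltrDl ltr01.
  apply/eqP; rewrite eq_le le0//= -oppr_le0 -mulN1r -dotpZr.
  by rewrite le0// memvZ.
split; first exact/tangent_coneP.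
move=> e e0; rewrite near_withinE; near=> z => /tangent_coneP[r yr zr].
have wr : w \in S_ r by move: (r) zr; near: z; exact: near_subspaces.
by rewrite (vr r)// ?mulr_ge0 ?enorm_ge0 ?(ltW e0)// memvB.
Unshelve. all: by end_near. Qed.

End UnionOfSubspaces.

(** * The Lagrangian of the problem *)

Section Lagrangian.
Context {R : realType} {n m p l q N : nat}.
Variable P : mpdsc R n m p l q N.
Local Notation X := 'rV[R]_n.
Implicit Types (x d w : X) (lg : 'rV[R]_m) (lh : 'rV[R]_p).
Implicit Types (lPhi : 'I_l -> 'rV[R]_q).

(** The multipliers [lPhi i] are put into the constraint functions, and so enter
    the Lagrangian with coefficient [1]. *)
Definition constr lPhi (j : 'I_m + ('I_p + 'I_l)) (x : X) : R :=
  match j with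
  | inl i => ineq P x 0 i
  | inr (inl i) => eqc P x 0 i
  | inr (inr i) => dotp (lPhi i) (Phi P i x)
  end.

Definition coefs lg lh (j : 'I_m + ('I_p + 'I_l)) : R :=
  match j with inl i => lg 0 i | inr (inl i) => lh 0 i | inr (inr _) => 1 end.

Lemma C1_coord k (F : X -> 'rV[R]_k) i : C1 F -> C1 (fun x => F x 0 i : R).
Proof.
by move=> CF; under eq_fun do rewrite -dotp_e; exact: C1_dotp.
Qed.

Lemma C2_coord k (F : X -> 'rV[R]_k) i : C2 F -> C2 (fun x => F x 0 i : R).
Proof. by move=> CF; under eq_fun do rewrite -dotp_e; exact: C2_dotp. Qed.

Lemma diff_coord k (F : X -> 'rV[R]_k) i x w : differentiable F x ->
  'd (fun x => F x 0 i : R) x w = 'd F x w 0 i.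
Proof.
by move=> dF; rewrite -[RHS]dotp_e; apply: diff_eq_dotp => // y; rewrite dotp_e.
Qed.

Lemma C1_constr lPhi j : smooth1 P -> C1 (constr lPhi j).
Proof.
move=> [_ Cg Ch CPhi]; case: j => [i|[i|i]] /=; first exact: C1_coord.
  exact: C1_coord.
exact: C1_dotp.
Qed.

Lemma C2_constr lPhi j : smooth2 P -> C2 (constr lPhi j).
Proof.
move=> [_ Cg Ch CPhi]; case: j => [i|[i|i]] /=; first exact: C2_coord.
  exact: C2_coord.
exact: C2_dotp.
Qed.

Lemma smooth2_smooth1 : smooth2 P -> smooth1 P.
Proof. by move=> [[? _] [? _] [? _] CPhi]; split=> // i; have [] := CPhi i. Qed.

Lemma lagrangian_affine_comb lg lh lPhi :
  lagrangian P lg lh lPhi = affine_comb (coefs lg lh) (obj P) (constr lPhi).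
Proof.
apply/funext => x; rewrite /lagrangian /affine_comb !big_sumType/= -!addrA.
by congr (_ + (_ + (_ + _))); apply: eq_bigr => i _; rewrite mul1r.
Qed.

Lemma C2_lagrangian lg lh lPhi : smooth2 P -> C2 (lagrangian P lg lh lPhi).
Proof.
move=> CP; rewrite lagrangian_affine_comb; apply: C2_affine_comb; first by case: CP.
by move=> j; exact: C2_constr.
Qed.

Lemma dotp_jacobian (lam : 'rV[R]_q) i x w :
  dotp (lam *m ('J (Phi P i) x)^T) w = dotp lam ('d (Phi P i) x w).
Proof.
rewrite /jacobian -mul_rV_lin1 !dotpE trmx_mul.
by rewrite mulmxA.
Qed.

Lemma diff_lagrangian lg lh lPhi x d w : smooth1 P ->
  (forall i, ~~ active P x d i -> lg 0 i = 0) ->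
  'd (lagrangian P lg lh lPhi) x w =
  'd (obj P) x w + dotp (constraint_grad P x d lg lh lPhi) w :> R.
Proof.
move=> CP lg0; have [Cf Cg Ch CPhi] := CP.
rewrite (diff_eq_affine_comb x w Cf (fun j => C1_constr lPhi j CP)
  (fun y => congr1 (fun F => F y) (lagrangian_affine_comb lg lh lPhi))).
congr (_ + _); rewrite !big_sumType/= /constraint_grad !dotpDl -addrA.
congr (_ + (_ + _)).
- rewrite (bigID (active P x d))/= [X in _ + X]big1 ?addr0; last first.
    by move=> i /lg0 ->; rewrite mul0r.
  rewrite dotp_suml; apply: eq_bigr => i _; rewrite dotpZl -grad_dotp//.
  by case: (C1_coord i Cg).
- rewrite dotp_suml; apply: eq_bigr => i _; rewrite dotpZl -grad_dotp//.
  by case: (C1_coord i Ch).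
- rewrite dotp_suml; apply: eq_bigr => i _.
  by rewrite mul1r dotp_jacobian diff_dotp//; case: (CPhi i).
Qed.

End Lagrangian.

(** * Stationarity along a fixed choice of subspaces *)

Section FixedChoice.
Context {R : realType} {n m p l q N : nat}.
Variables (P : mpdsc R n m p l q N) (x d : 'rV[R]_n).
Local Notation X := 'rV[R]_n.
Local Notation f := (obj P).
Local Notation g := (ineq P).
Local Notation h := (eqc P).
Local Notation Phi := (Phi P).
Local Notation S_ := (subsp P).
Variables (r : 'I_l -> 'I_N) (K : 'I_l -> nat) (D : forall i, 'M[R]_(K i, q)).
Hypothesis (freeD : forall i, row_free (D i)).
Hypothesis (eqnD : forall i y, (y \in S_ (r i)) <->
  forall j, dotp (row j (D i)) y = 0).
Hypothesis (CP : smooth1 P) (xfeas : feasible P x) (crit : critical_cone P x d).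
Hypothesis (xr : forall i, Phi i x \in S_ (r i)).
Hypothesis (dr : forall i, 'd (Phi i) x d \in S_ (r i)).

Definition red_index : finType :=
  ({i : 'I_m | active P x d i} + ('I_p + {i : 'I_l & 'I_(K i)}))%type.

(** Prescribing that [Phi i] stays in the subspace [S_ (r i)] gives an ordinary
    nonlinear program.  Only the inequalities active along [d] are kept, so that
    each of these functions vanishes at [x] and has zero derivative along [d]. *)
Definition red (j : red_index) (y : X) : R :=
  match j with
  | inl i => g y 0 (val i)
  | inr (inl i) => h y 0 i
  | inr (inr a) => dotp (row (tagged a) (D (tag a))) (Phi (tag a) y)
  end.

Definition red_eqn (j : red_index) : bool := if j is inl _ then false else true.

Definition lg_of (nu : red_index -> R) : 'rV[R]_m :=
  \row_i if insub i is Some j then nu (inl j) else 0.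

Definition lh_of (nu : red_index -> R) : 'rV[R]_p := \row_i nu (inr (inl i)).

Definition lPhi_of (nu : red_index -> R) (i : 'I_l) : 'rV[R]_q :=
  (\row_j nu (inr (inr (Tagged (fun i => 'I_(K i)) j)))) *m D i.

Lemma C1_red j : C1 (red j).
Proof.
have [_ Cg Ch CPhi] := CP.
case: j => [i|[i|a]] /=; [exact: C1_coord | exact: C1_coord | exact: C1_dotp].
Qed.

Lemma C2_red j : smooth2 P -> C2 (red j).
Proof.
move=> [_ Cg Ch CPhi].
case: j => [i|[i|a]] /=; [exact: C2_coord | exact: C2_coord | exact: C2_dotp].
Qed.

Lemma red0 j : red j x = 0.
Proof.
have [_ hx _] := xfeas.
case: j => [i|[i|a]] /=; first by have /andP[/eqP] := valP i.
  by rewrite hx mxE.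
by have /eqnD := xr (tag a); apply.
Qed.

Lemma diff_red0 j : 'd (red j) x d = 0 :> R.
Proof.
have [_ Cg Ch CPhi] := CP; have [_ hd _ _] := crit.
case: j => [i|[i|a]] /=.
- rewrite (diff_coord _ d (Cg.1 x)).
  by have /andP[_ /eqP] := valP i.
- by rewrite (diff_coord _ d (Ch.1 x)) hd mxE.
- by rewrite (diff_dotp _ d ((CPhi _).1 x)); have /eqnD := dr (tag a); apply.
Qed.

Lemma lg_of_inactive nu i : ~~ active P x d i -> lg_of nu 0 i = 0.
Proof. by move=> ai; rewrite mxE insubN. Qed.

Lemma lg_of_active nu (i : {i | active P x d i}) : lg_of nu 0 (val i) = nu (inl i).
Proof. by rewrite mxE valK. Qed.

(** This is what makes multipliers of the program with prescribed subspaces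
    multipliers of the original problem. *)
Lemma lagrangian_of nu :
  lagrangian P (lg_of nu) (lh_of nu) (lPhi_of nu) = affine_comb nu f red.
Proof.
apply/funext => y; rewrite /lagrangian /affine_comb !big_sumType/= -!addrA.
congr (_ + (_ + (_ + _))).
- rewrite /dotp (bigID (active P x d))/= [X in _ + X]big1 ?addr0; last first.
    by move=> i /lg_of_inactive ->; rewrite mul0r.
  by rewrite (big_sub (active P x d)); apply: eq_bigr => i _; rewrite lg_of_active.
- by apply: eq_bigr => i _; rewrite mxE.
- rewrite (eq_bigr (fun i => \sum_j
      nu (inr (inr (Tagged (fun i => 'I_(K i)) j))) *
      dotp (row j (D i)) (Phi i y))).
    rewrite sig_big_dep; apply: eq_big => // -[i j] _ //.
  move=> i _; rewrite /lPhi_of mulmx_sum_row dotp_suml.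
  by apply: eq_bigr => j _; rewrite dotpZl mxE.
Qed.

Lemma constraint_grad_of nu w :
  dotp (constraint_grad P x d (lg_of nu) (lh_of nu) (lPhi_of nu)) w =
  \sum_j nu j * 'd (red j) x w.
Proof.
have [Cf _ _ _] := CP.
have := @diff_lagrangian R n m p l q N P (lg_of nu) (lh_of nu) (lPhi_of nu) x d
  w CP (@lg_of_inactive nu).
rewrite (diff_eq_affine_comb x w Cf C1_red
  (fun y => congr1 (fun F => F y) (lagrangian_of nu))).
by move=> /addrI.
Qed.

Lemma lPhi_of_orth nu i : orth (S_ (r i)) (lPhi_of nu i).
Proof.
move=> u /eqnD ur; rewrite /lPhi_of mulmx_sum_row dotp_suml big1// => j _.
by rewrite dotpZl ur mulr0.
Qed.

Lemma penalized_choice (k : R) : 0 <= k -> penalized red_eqn f red x d k ->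
  exists lg lh lPhi, [/\ multiplier P x d lg lh lPhi,
    forall i, orth (S_ (r i)) (lPhi i) &
    smooth2 P -> 0 <= lagrangian_curv P x d lg lh lPhi].
Proof.
move=> k0 pen; have [Cf _ _ _] := CP; have [_ _ _ fd] := crit.
have [nu [nu0 dnu cnu]] :=
  penalized_multiplier pen Cf C1_red red0 diff_red0 fd k0.
exists (lg_of nu), (lh_of nu), (lPhi_of nu); split.
- split=> [i ai|i|]; last 1 first.
  + apply/rowP => i; rewrite [RHS]mxE -dotp_e dotpC dotpDl constraint_grad_of.
    rewrite -grad_dotp; last by case: Cf.
    exact: etrans (esym (diff_affine_comb nu x 'e_i Cf C1_red)) (dnu 'e_i).
  + by rewrite -[i]/(val (Sub i ai : {i | active P x d i})) lg_of_active nu0.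
  + exact: lg_of_inactive.
- exact: lPhi_of_orth.
- move=> C2P; rewrite /lagrangian_curv lagrangian_of; apply: cnu.
    by case: C2P.
  by move=> j; exact: C2_red.
Qed.

End FixedChoice.

(** * Exact penalization under directional linear independence *)

Section ChoicePenalty.
Context {R : realType} {n m p l q N : nat}.
Variables (P : mpdsc R n m p l q N) (x d : 'rV[R]_n).
Local Notation X := 'rV[R]_n.
Local Notation f := (obj P).
Local Notation g := (ineq P).
Local Notation h := (eqc P).
Local Notation Phi := (Phi P).
Local Notation S_ := (subsp P).
Variables (r : 'I_l -> 'I_N) (K : 'I_l -> nat) (D : forall i, 'M[R]_(K i, q)).
Hypothesis (freeD : forall i, row_free (D i)).
Hypothesis (eqnD : forall i y, (y \in S_ (r i)) <->
  forall j, dotp (row j (D i)) y = 0).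
Hypothesis (CP : smooth1 P) (xfeas : feasible P x) (crit : critical_cone P x d).
Hypothesis (xr : forall i, Phi i x \in S_ (r i)).
Hypothesis (dr : forall i, 'd (Phi i) x d \in S_ (r i)).

Local Notation red := (@red R n m p l q N P x d K D).
Local Notation red_eqn := (@red_eqn R n m p l q N P x d K).
Local Notation C1_red := (C1_red (P := P) (x := x) (d := d) D CP).

(** An inequality leaves the active set either because it is strict at [x], or
    because it strictly decreases along [d]. *)
Lemma inactive_negative : \forall a \near dirf R d,
  forall i, ~~ active P x d i -> g (x + a.1 *: a.2) 0 i < 0.
Proof.
have [_ Cg _ _] := CP; have [gx _ _] := xfeas; have [gd _ _ _] := crit.
have hi i : \forall a \near dirf R d,
    ~~ active P x d i -> g (x + a.1 *: a.2) 0 i < 0.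
  have [dgi _] := C1_coord i Cg.
  have [gi|gi] := eqVneq (g x 0 i) 0; last first.
    have gxi : g x 0 i < 0 by rewrite lt_neqAle gi gx.
    have cg : {for x, continuous (fun y => g y 0 i : R)}.
      exact: differentiable_continuous.
    have gc : (fun a : R * X => g (x + a.1 *: a.2) 0 i : R) @ dirf R d --> g x 0 i.
      exact: (cvg_comp _ _ (@dirf_base R n d x) cg).
    by apply: filterS (cvgr_lt _ gc _ gxi) => a.
  have [gdi|gdi] := eqVneq ('d g x d 0 i) 0.
    by near=> a; rewrite /active/= gi gdi !eqxx.
  have gdi0 : 'd (fun y => g y 0 i : R) x d < 0.
    by rewrite diff_coord ?lt_neqAle ?gdi ?gd//; case: Cg.
  have gq := @dirf_quotient R n d _ x (dgi x).
  near=> a => _; have a0 : 0 < a.1 by near: a; exact: dirf_pos.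
  have : a.1^-1 * (g (x + a.1 *: a.2) 0 i - g x 0 i) < 0.
    by near: a; exact: (cvgr_lt _ gq _ gdi0).
  by rewrite gi subr0 pmulr_rlt0// invr_gt0.
exact: (filter_forall _ hi).
Unshelve. all: by end_near. Qed.

Lemma sum_orth_orth (y z u : 'rV[R]_q) s : y \in S_ s -> z \in S_ s ->
  orth (S_ s) u -> sum_orth P y z u.
Proof.
move=> ys zs us; exists (fun s' => if s' == s then u else 0).
  move=> s' _ _; case: eqP => [->//|_] w _.
  by rewrite dotpC -(scale0r 0) dotpZr mul0r.
rewrite (bigD1 s) ?ys ?zs//= eqxx big1 ?addr0// => s' /andP[_ ss'].
by rewrite (negbTE ss').
Qed.

(** A multiplier of the equations of [S_ (r i)] is orthogonal to that subspace,
    hence lies in the sum of orthogonal complements over all subspaces that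
    contain [Phi i x] and its derivative; independence of the equations then
    transfers the vanishing back to their multipliers. *)
Lemma licq_independent : MPDSC_LICQ P x d -> forall nu : red_index P x d K -> R,
  (forall w, \sum_j nu j * 'd (red j) x w = 0) -> forall j, nu j = 0.
Proof.
move=> licq nu hnu.
have [|||lg0 lh0 lPhi0] := licq (lg_of nu) (lh_of nu) (lPhi_of D nu).
- exact: lg_of_inactive.
- move=> i; apply: (@sum_orth_orth _ _ _ (r i)) => //.
  exact: (lPhi_of_orth eqnD).
- apply/rowP => i; rewrite [RHS]mxE -dotp_e dotpC (constraint_grad_of D CP).
  exact: hnu.
case=> [i|[i|[i j]]].
- by rewrite -lg_of_active lg0 mxE.
- by have := congr1 (fun v : 'rV_p => v 0 i) lh0; rewrite !mxE.
- have := lPhi0 i; rewrite -(mul0mx _ (D i)) => /(row_free_inj (freeD i)).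
  by move=> /(congr1 (fun v : 'rV_(K i) => v 0 j)); rewrite !mxE.
Qed.

Lemma admissible_feasible (y : X) :
  (forall i, ~~ active P x d i -> g y 0 i < 0) ->
  (forall j, admissible (red_eqn j) (red j y)) -> feasible P y.
Proof.
move=> gneg adm; split=> [i||i].
- have [ai|/gneg/ltW//] := boolP (active P x d i).
  exact: (adm (inl (Sub i ai))).
- by apply/rowP => i; rewrite mxE; exact: (adm (inr (inl i))).
- exists (r i); apply/eqnD => j.
  exact: (adm (inr (inr (Tagged (fun i => 'I_(K i)) j)))).
Qed.

Lemma licq_penalized : local_min P x -> MPDSC_LICQ P x d ->
  exists2 k : R, 0 <= k & penalized red_eqn f red x d k.
Proof.
move=> [_ xmin] licq; have [Cf _ _ _] := CP.
apply: (@indep_penalized _ _ _ red x C1_red (licq_independent licq)) => //.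
- by move=> j; exact: red0.
- by move=> j; exact: diff_red0.
near=> a => adm.
have am : feasible P (x + a.1 *: a.2) -> f x <= f (x + a.1 *: a.2).
  by near: a; exact: (@dirf_base R n d x _ xmin).
apply: am; apply: admissible_feasible => //.
by near: a; exact: inactive_negative.
Unshelve. all: by end_near. Qed.

End ChoicePenalty.
(** * Exact penalization under directional metric subregularity *)

Section DirectionalNeighbourhood.
Context {R : realType} {n : nat}.
Implicit Types (d z : 'rV[R]_n).

Lemma enorm_continuous : continuous (@enorm R n).
Proof.
move=> z; have cd : (fun u : 'rV[R]_n => dotp u u) @ z --> dotp z z.
  have ci i : continuous (fun u : 'rV[R]_n => u 0 i * u 0 i : R).
    move=> u; exact: (cvgM (@coord_continuous R 1 n 0 i u)
                           (@coord_continuous R 1 n 0 i u)).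
  exact: (cvg_sumr (fun i => ci i z)).
exact: (cvg_comp _ _ cd (@sqrt_continuous R (dotp z z))).
Qed.

Lemma dirf_dir_nbhd (rho delta : R) d : 0 < rho -> 0 < delta ->
  \forall a \near dirf R d, dir_nbhd rho delta d (a.1 *: a.2).
Proof.
move=> rho0 delta0.
have zc : (fun a : R * 'rV[R]_n => a.1 *: a.2) @ dirf R d --> (0 : 'rV[R]_n).
  have h : (fun a : R * 'rV[R]_n => a.1 *: a.2) @ dirf R d --> 0 *: d.
    exact: (cvgZ (@dirf_fst0 R n d) (@dirf_snd R n d)).
  by rewrite scale0r in h.
have small : \forall a \near dirf R d, enorm (a.1 *: a.2) < rho.
  have ec := cvg_comp _ _ zc (@enorm_continuous 0).
  apply: (cvgr_lt _ ec).
  by have /eqP -> : enorm (0 : 'rV[R]_n) == 0 by rewrite enorm_eq0.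
have cone : \forall v \near d,
    enorm (enorm d *: v - enorm v *: d) <= delta * enorm v * enorm d.
  have [->|d0] := eqVneq d 0.
    near=> v; have /eqP -> : enorm (0 : 'rV[R]_n) == 0 by rewrite enorm_eq0.
    rewrite scale0r scaler0 subr0 mulr0.
    by have /eqP -> : enorm (0 : 'rV[R]_n) == 0 by rewrite enorm_eq0.
  have ed : 0 < enorm d by rewrite lt_neqAle enorm_ge0 eq_sym enorm_eq0 d0.
  pose phi v := delta * enorm v * enorm d - enorm (enorm d *: v - enorm v *: d).
  have phic : phi @ d --> phi d.
    have c1 : continuous (fun v : 'rV[R]_n => enorm d *: v).
      exact: scaler_continuous.
    have c2 : continuous (fun v : 'rV[R]_n => enorm v *: d).
      move=> v; exact: (cvg_comp _ _ (@enorm_continuous v)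
                                     (@scalel_continuous _ _ d (enorm v))).
    have h1 : continuous (fun v : 'rV[R]_n => enorm d *: v - enorm v *: d).
      by move=> v; exact: (cvgB (c1 v) (c2 v)).
    have h2 := cvg_comp _ _ (h1 d) (@enorm_continuous _).
    have h3 : continuous (fun v : 'rV[R]_n => delta * enorm v * enorm d).
      move=> v; exact: (cvgM (cvgM (cvg_cst delta) (@enorm_continuous v))
                             (cvg_cst (enorm d))).
    exact: (cvgB (h3 d) h2).
  have phid : 0 < phi d.
    rewrite /phi subrr.
    have /eqP -> : enorm (0 : 'rV[R]_n) == 0 by rewrite enorm_eq0.
    by rewrite subr0 !mulr_gt0.
  by apply: filterS (cvgr_gt _ phic _ phid) => v; rewrite subr_gt0 => /ltW.
near=> a; split; first by near: a.
have a0 : 0 < a.1 by near: a; exact: dirf_pos.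
have ca : enorm (enorm d *: a.2 - enorm a.2 *: d) <= delta * enorm a.2 * enorm d.
  by near: a; exact: (@dirf_snd R n d _ cone).
rewrite enormZ ?(ltW a0)//.
have -> : enorm d *: (a.1 *: a.2) - (a.1 * enorm a.2) *: d =
    a.1 *: (enorm d *: a.2 - enorm a.2 *: d).
  by rewrite scalerBr !scalerA [enorm d * _]mulrC.
rewrite enormZ ?(ltW a0)// mulrCA -mulrA ler_pM2l//.
Unshelve. all: by end_near. Qed.

Lemma dist_le (Omega : set 'rV[R]_n) y z :
  Omega z -> dist Omega y <= enorm (y - z).
Proof.
move=> Oz; apply: ge_inf; last by exists z.
by exists 0 => _ [u _ <-]; exact: enorm_ge0.
Qed.

Lemma dist_lt (Omega : set 'rV[R]_n) y (b : R) : Omega !=set0 -> dist Omega y < b ->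
  exists2 z, Omega z & enorm (y - z) < b.
Proof.
move=> [z0 Oz0] yb; have [||_ [z Oz <-] zb] := @inf_adherent R
    [set enorm (y - z) | z in Omega] (b - dist Omega y).
- by rewrite subr_gt0.
- split; first by exists (enorm (y - z0)), z0.
  by exists 0 => _ [u _ <-]; exact: enorm_ge0.
by exists z => //; move: zb; rewrite [ltRHS]addrC subrK.
Qed.

End DirectionalNeighbourhood.

Section Subregularity.
Context {R : realType} {n m p l q N : nat}.
Variables (P : mpdsc R n m p l q N) (x d : 'rV[R]_n).
Local Notation X := 'rV[R]_n.
Local Notation f := (obj P).
Local Notation g := (ineq P).
Local Notation h := (eqc P).
Local Notation Phi := (Phi P).
Local Notation S_ := (subsp P).
Variables (r : 'I_l -> 'I_N) (K : 'I_l -> nat) (D : forall i, 'M[R]_(K i, q)).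
Hypothesis (freeD : forall i, row_free (D i)).
Hypothesis (eqnD : forall i y, (y \in S_ (r i)) <->
  forall j, dotp (row j (D i)) y = 0).
Hypothesis (CP : smooth1 P) (xfeas : feasible P x) (crit : critical_cone P x d).
Hypothesis (xr : forall i, Phi i x \in S_ (r i)).
Hypothesis (dr : forall i, 'd (Phi i) x d \in S_ (r i)).

Local Notation red := (@red R n m p l q N P x d K D).
Local Notation red_eqn := (@red_eqn R n m p l q N P x d K).
Local Notation C1_red := (C1_red (P := P) (x := x) (d := d) D CP).


Definition residual (y : X) : R :=
  \sum_i Num.max (g y 0 i) 0 + \sum_i `|h y 0 i| + \sum_i dist (Sset P) (Phi i y).

(** Measuring the distance to one subspace of the union only increases the
    residual. *)
Lemma residual_bound : exists2 B : R, 0 <= B & \forall a \near dirf R d,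
  residual (x + a.1 *: a.2) <=
  B * \sum_j pen (red_eqn j) (red j (x + a.1 *: a.2)).
Proof.
have [C hC] : exists C : 'I_l -> R, forall i, 0 <= C i /\ forall y,
    dist (Sset P) y <= C i * \sum_j `|dotp (row j (D i)) y|.
  have h i : exists C : R, 0 <= C /\ forall y,
      dist (Sset P) y <= C * \sum_j `|dotp (row j (D i)) y|.
    have [C C0 hC] := subspace_error_bound (freeD i) (@eqnD i).
    exists C; split=> // y; have [z zr yz] := hC y.
    by apply: le_trans yz; apply: dist_le; exists (r i).
  by have [C hC] := choice h; exists C.
have C0 i : 0 <= C i by case: (hC i).
have B0 : 0 <= \sum_i C i by apply: sumr_ge0.
exists (1 + \sum_i C i); first by rewrite addr_ge0.
near=> a.
have : forall i, ~~ active P x d i -> g (x + a.1 *: a.2) 0 i < 0.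
  by near: a; exact: (inactive_negative CP xfeas crit).
set y := x + a.1 *: a.2 => gneg.
pose A1 := \sum_i Num.max (g y 0 i) 0; pose A2 := \sum_i `|h y 0 i|.
pose A3 := \sum_i \sum_j `|dotp (row j (D i)) (Phi i y)|.
have A10 : 0 <= A1 by apply: sumr_ge0 => i _; rewrite le_max lexx orbT.
have A20 : 0 <= A2 by apply: sumr_ge0.
have A30 : 0 <= A3 by apply: sumr_ge0 => i _; apply: sumr_ge0.
have -> : \sum_j pen (red_eqn j) (red j y) = A1 + (A2 + A3).
  rewrite !big_sumType/=; congr (_ + (_ + _)).
    rewrite /A1 (bigID (active P x d))/= [X in _ + X]big1 ?addr0; last first.
      by move=> i /gneg/ltW/max_idPr.
    by rewrite (big_sub (active P x d)).
  by rewrite /A3 sig_big_dep; apply: eq_bigr => -[i j] _.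
have A3le : \sum_i dist (Sset P) (Phi i y) <= (\sum_i C i) * A3.
  rewrite mulr_suml; apply: ler_sum => i _.
  have [_ hCi] := hC i; apply: le_trans (hCi _) _; apply: ler_wpM2l => //.
  by rewrite /A3 (bigD1 i)//= lerDl; apply: sumr_ge0 => j _; apply: sumr_ge0.
rewrite /residual -/A1 -/A2; apply: le_trans (lerD (lexx _) A3le) _.
have c1 := mulr_ge0 B0 A10; have c2 := mulr_ge0 B0 A20.
move: (\sum_i C i) A1 A2 A3 A10 A20 A30 c1 c2 {A3le} => c a1 a2 a3 h1 h2 h3 h4 h5.
by rewrite mulrDl mul1r !mulrDr; lra.
Unshelve. all: by end_near. Qed.

(** Nearly nearest feasible points [z] to [y] are close to [x], where [f x <= f z];
    and [f z] exceeds [f y] by at most a Lipschitz constant times the distance,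
    which subregularity bounds by the residual. *)
Lemma mscq_penalized : local_min P x -> MSCQ P x d ->
  exists2 k : R, 0 <= k & penalized red_eqn f red x d k.
Proof.
move=> [_ xmin] [alpha [rho [delta [alpha0 rho0 delta0 hms]]]].
have [Cf _ _ _] := CP.
have [B B0 hB] := residual_bound.
have [L L0 [etaL etaL0 hL]] := C1_lipschitz x Cf.
have [eta1 eta10 heta1] := (near_distP x _).1 xmin.
pose S (y : X) := \sum_j pen (red_eqn j) (red j y).
have S0 y : 0 <= S y by apply: sumr_ge0 => j _; exact: pen_ge0.
exists (L * (alpha * B)); first by rewrite !mulr_ge0.
pose e := Num.min eta1 etaL / 3.
have e0 : 0 < e by rewrite divr_gt0// lt_min eta10.
have aB1 : 0 < alpha * B + 1 by rewrite ltr_wpDl// mulr_ge0.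
have e3 : e + e + e = Num.min eta1 etaL by rewrite /e; field.
near=> a.
have yx : `|x + a.1 *: a.2 - x| < e.
  near: a; apply: (@dirf_base R n d x (fun z => `|z - x| < e)).
  exact: near_dist_lt.
have hBy : residual (x + a.1 *: a.2) <= B * S (x + a.1 *: a.2) by near: a.
have Sy : S (x + a.1 *: a.2) < a.1 * 1.
  near: a; apply: (pen_sum_small C1_red) => // j; last exact: diff_red0.
  exact: red0.
have a1 : a.1 < e / (alpha * B + 1).
  by near: a; apply: dirf_lt; rewrite divr_gt0.
have dirz : dir_nbhd rho delta d (a.1 *: a.2).
  by near: a; exact: dirf_dir_nbhd.
have := hms _ dirz; rewrite -/(residual (x + a.1 *: a.2)) => hmsy.
rewrite -/(S (x + a.1 *: a.2)); set y := x + a.1 *: a.2 in yx hBy Sy hmsy *.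
pose beta := alpha * (B * S y).
have betaE : beta = alpha * B * S y by rewrite /beta mulrA.
have hdist : dist (feasible P) y <= beta.
  by apply: le_trans hmsy _; apply: ler_wpM2l.
have beta_e : beta < e.
  apply: le_lt_trans (_ : (alpha * B + 1) * S y < _).
    by rewrite betaE mulrDl lerDl mul1r.
  by rewrite -ltr_pdivlMl// mulrC; apply: lt_trans Sy _; rewrite mulr1.
apply/ler_addgt0Pr => e' e'0.
have L1 : 0 < L + 1 by rewrite ltr_wpDl.
pose eps := Num.min e (e' / (L + 1)).
have eps0 : 0 < eps by rewrite lt_min e0 divr_gt0.
have [||z zfeas yz] := @dist_lt R n (feasible P) y (beta + eps).
- by exists x; case: xfeas.
- by apply: le_lt_trans hdist _; rewrite ltrDl.
have zy : `|z - y| < beta + eps.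
  by rewrite distrC; apply: le_lt_trans (norm_le_enorm _) yz.
have zx : `|z - x| < Num.min eta1 etaL.
  rewrite -(subrK y z) -addrA; apply: le_lt_trans (ler_normD _ _) _.
  rewrite -e3; apply: ltrD yx; apply: lt_le_trans zy _.
  by apply: lerD; [exact: ltW | rewrite ge_min lexx].
have yL : `|y - x| < etaL.
  apply: lt_trans yx _; apply: lt_le_trans (_ : Num.min eta1 etaL <= _).
    by rewrite -e3 -addrA ltrDl addr_gt0.
  by rewrite ge_min lexx orbT.
move: zx; rewrite lt_min => /andP[zx1 zxL].
have fxz := heta1 z zx1 zfeas.
have fzy := hL y z yL zxL.
have fz : f z <= f y + L * (beta + eps).
  rewrite -lerBlDl; apply: le_trans (ler_norm _) _; apply: le_trans fzy _.
  by apply: ler_wpM2l => //; exact: ltW.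
apply: le_trans fxz _; apply: le_trans fz _.
rewrite -addrA lerD2l mulrDr betaE mulrA lerD2l.
apply: le_trans (_ : L * (e' / (L + 1)) <= _).
  by apply: ler_wpM2l => //; rewrite ge_min lexx orbT.
rewrite mulrCA; apply: ler_piMr; first exact: ltW.
by rewrite ler_pdivrMr// mul1r lerDl.
Unshelve. all: by end_near. Qed.

End Subregularity.
(** * Necessary conditions *)

Section Necessary.
Context {R : realType} {n m p l q N : nat}.
Variables (P : mpdsc R n m p l q N) (x d : 'rV[R]_n).
Local Notation S_ := (subsp P).
Hypothesis (CP : smooth1 P) (xmin : local_min P x) (crit : critical_cone P x d).

Lemma choice_equations (r : 'I_l -> 'I_N) :
  exists (K : 'I_l -> nat) (D : forall i, 'M[R]_(K i, q)),
    (forall i, row_free (D i)) /\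
    forall i y, (y \in S_ (r i)) <-> forall j, dotp (row j (D i)) y = 0.
Proof.
have h i : exists kD : {k : nat & 'M[R]_(k, q)}, row_free (projT2 kD) /\
    forall y, (y \in S_ (r i)) <-> forall j, dotp (row j (projT2 kD)) y = 0.
  by have [k [D hD]] := subspace_equations (S_ (r i)); exists (existT _ k D).
have [E hE] := choice h.
exists (fun i => projT1 (E i)), (fun i => projT2 (E i)).
by split=> i; have [] := hE i.
Qed.

Definition admissible_choice (r : 'I_l -> 'I_N) : Prop :=
  forall i, Phi P i x \in S_ (r i) /\ 'd (Phi P i) x d \in S_ (r i).

Definition choice_multiplier (r : 'I_l -> 'I_N) lg lh lPhi : Prop :=
  [/\ multiplier P x d lg lh lPhi, forall i, orth (S_ (r i)) (lPhi i) &
    smooth2 P -> 0 <= lagrangian_curv P x d lg lh lPhi].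

Lemma mscq_multiplier r : MSCQ P x d -> admissible_choice r ->
  exists lg lh lPhi, choice_multiplier r lg lh lPhi.
Proof.
move=> ms rP; have [K [D [freeD eqnD]]] := choice_equations r.
have xr i := (rP i).1; have dr i := (rP i).2.
have [k k0 pen] := mscq_penalized freeD eqnD CP xmin.1 crit xr dr xmin ms.
exact: (penalized_choice eqnD CP xmin.1 crit xr dr k0 pen).
Qed.

Lemma licq_multiplier r : MPDSC_LICQ P x d -> admissible_choice r ->
  exists lg lh lPhi, choice_multiplier r lg lh lPhi.
Proof.
move=> licq rP; have [K [D [freeD eqnD]]] := choice_equations r.
have xr i := (rP i).1; have dr i := (rP i).2.
have [k k0 pen] := licq_penalized freeD eqnD CP xmin.1 crit xr dr xmin licq.
exact: (penalized_choice eqnD CP xmin.1 crit xr dr k0 pen).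
Qed.

(** Among the subspaces containing both [Phi i x] and its derivative along [d],
    one of largest dimension is not contained in any other subspace. *)
Lemma maximal_choice : exists2 r, admissible_choice r &
  forall i r', (S_ (r i) <= S_ r')%VS -> (S_ r' <= S_ (r i))%VS.
Proof.
have [_ _ cPhi _] := crit.
have h i : exists r, (Phi P i x \in S_ r /\ 'd (Phi P i) x d \in S_ r) /\
    forall r', (S_ r <= S_ r')%VS -> (S_ r' <= S_ r)%VS.
  have [r0 xr0 dr0] := cPhi i.
  pose Q r := (Phi P i x \in S_ r) && ('d (Phi P i) x d \in S_ r).
  have Q0 : Q r0 by rewrite /Q xr0.
  case: (arg_maxnP (fun r => \dim (S_ r)) Q0) => r /andP[xr dr] rmax.
  exists r; split=> // r' rr'.
  have Qr' : Q r' by rewrite /Q !(subvP rr').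
  have /eqP -> : (S_ r == S_ r')%VS by rewrite eqEdim rr'; exact: rmax.
  exact: subvv.
have [r hr] := choice h.
by exists r => i; have [] := hr i.
Qed.

Lemma mscq_M_multiplier : MSCQ P x d -> exists lg lh lPhi,
  M_multiplier P x d lg lh lPhi /\
  (smooth2 P -> 0 <= lagrangian_curv P x d lg lh lPhi).
Proof.
move=> ms; have [r rP rmax] := maximal_choice.
have [lg [lh [lPhi [mult lo curv0]]]] := mscq_multiplier ms rP.
exists lg, lh, lPhi; split=> //; split=> // i.
by have [xr dr] := rP i; exact: (orth_sub_dir_normal xr dr (rmax i) (lo i)).
Qed.

Lemma constraint_gradB lg lh lPhi lg' lh' lPhi' :
  constraint_grad P x d (lg - lg') (lh - lh') (fun i => lPhi i - lPhi' i) =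
  constraint_grad P x d lg lh lPhi - constraint_grad P x d lg' lh' lPhi'.
Proof.
rewrite /constraint_grad opprD addrACA [in RHS]opprD.
rewrite [X in _ = X + _]addrACA -!sumrB.
congr (_ + _ + _); apply: eq_bigr => i _; last by rewrite mulmxBl.
  by rewrite !mxE scalerBl.
by rewrite !mxE scalerBl.
Qed.

Lemma sum_orthB y z u v : sum_orth P y z u -> sum_orth P y z v ->
  sum_orth P y z (u - v).
Proof.
move=> [mu hmu ->] [mu' hmu' ->]; exists (fun r => mu r - mu' r).
  move=> r yr zr w wr; rewrite dotpC dotpBr !(dotpC w).
  by rewrite (hmu r)// (hmu' r)// subrr.
by rewrite sumrB.
Qed.

(** The multipliers of any two choices are both multipliers of the linearized
    system on which the gradients are independent, hence they coincide; the
    common multiplier is orthogonal to all the subspaces at once. *)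
Lemma licq_S_multiplier : MPDSC_LICQ P x d -> exists lg lh lPhi,
  S_multiplier P x d lg lh lPhi /\
  (smooth2 P -> 0 <= lagrangian_curv P x d lg lh lPhi).
Proof.
move=> licq; have [r rP _] := maximal_choice.
have [lg [lh [lPhi [mult lo curv0]]]] := licq_multiplier licq rP.
exists lg, lh, lPhi; split=> //; split=> // i.
have [xri dri] := rP i; apply/tangent_normalP; first by exists (r i).
move=> s xs ds; pose r' j := if j == i then s else r j.
have r'P : admissible_choice r'.
  by move=> j; rewrite /r'; case: eqP => [->|_]; [split|exact: rP].
have [lg' [lh' [lPhi' [mult' lo' _]]]] := licq_multiplier licq r'P.
have [_ lg0 stat] := mult; have [_ lg'0 stat'] := mult'.
have [|||_ _ same] := licq (lg - lg') (lh - lh') (fun i => lPhi i - lPhi' i).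
- by move=> j aj; rewrite !mxE lg0// lg'0// subrr.
- move=> j; apply: sum_orthB.
    by have [xr dr] := rP j; exact: (sum_orth_orth xr dr (lo j)).
  by have [xr dr] := r'P j; exact: (sum_orth_orth xr dr (lo' j)).
- rewrite constraint_gradB; apply/eqP; rewrite subr_eq0; apply/eqP.
  by apply: (addrI (grad (obj P) x)); rewrite stat stat'.
have /eqP := same i; rewrite subr_eq0 => /eqP ->.
by have := lo' i; rewrite /r' eqxx.
Qed.

End Necessary.

(** * Sufficient conditions *)

Section Sufficient.
Context {R : realType} {n m p l q N : nat}.
Variables (P : mpdsc R n m p l q N) (x : 'rV[R]_n).
Local Notation X := 'rV[R]_n.
Local Notation f := (obj P).
Local Notation g := (ineq P).
Local Notation h := (eqc P).
Local Notation Phi := (Phi P).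
Local Notation S_ := (subsp P).

Lemma ultra_fmap (T U : Type) (G : set_system T) (v : T -> U) :
  UltraFilter G -> UltraFilter (v @ G).
Proof.
move=> GU; split => [|H HF GH]; first exact: fmap_proper_filter.
apply/seteqP; split=> // A HA.
have [//|nA] := in_ultra_setVsetC (v @^-1` A) GU.
have : H (A `&` ~` A) by apply: filterI HA _; exact: GH.
by rewrite setICr => /filter_not_empty.
Qed.

Lemma cvg_le0 (T : Type) (G : set_system T) {PG : ProperFilter G}
    (u : T -> R) (b : R) :
  u @ G --> b -> (\forall a \near G, u a <= 0) -> b <= 0.
Proof.
move=> ub u0; rewrite -oppr_ge0; apply: (cvg_ge0 (cvgN ub)).
by apply: filterS u0 => a; rewrite oppr_ge0.
Qed.

(** If a set accumulates at [x], some filter of its points converging to [x]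
    has normalized displacements converging to a nonzero direction, by
    compactness of the unit sphere. *)
Lemma limit_direction (Bad : set X) : (forall y, Bad y -> y != x) ->
  ~ (\forall y \near x, ~ Bad y) ->
  exists (G : set_system X) (t : X -> R) (v : X -> X) (d : X),
    [/\ ProperFilter G,
      (\forall y \near G, [/\ Bad y, 0 < t y & y = x + t y *: v y]),
      (fun y => y) @ G --> x, t @ G --> 0 & v @ G --> d /\ d != 0].
Proof.
move=> Badx accu.
have PF : ProperFilter (within Bad (nbhs x)).
  apply: Build_ProperFilter_ex => A wA.
  have BA : \forall y \near x, Bad y -> A y by exact: wA.
  by apply: contrapT => nA; apply: accu; apply: filterS BA => y BAy By;
    apply: nA; exists y; exact: BAy.
have [G [GU FG]] := ultraFilterLemma PF.
have PG : ProperFilter G by exact: ultra_proper.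
have inBad : \forall y \near G, Bad y.
  by apply: FG; apply: (@filterE _ (nbhs x) _ (fun y => Bad y -> Bad y)).
have Gx : (fun y => y) @ G --> x.
  by move=> A xA; apply: FG; apply: filterS xA => y ? ?.
pose t y := `|y - x|; pose v y := (t y)^-1 *: (y - x).
have tpos y : Bad y -> 0 < t y by move=> /Badx yx; rewrite normr_gt0 subr_eq0.
have vsphere : \forall y \near G, `|v y| = 1.
  apply: filterS inBad => y /tpos ty.
  by rewrite normrZ gtr0_norm ?invr_gt0// mulVf// gt_eqF.
have := @closed_ball0_compact R n 1; rewrite compact_ultra => /(_ (v @ G)).
have sph1 : \forall y \near G, `|v y| <= 1 by apply: filterS vsphere => y ->.
move=> /(_ (ultra_fmap v GU) sph1) [d [_ /= vd]].
exists G, t, v, d; split => //.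
- apply: filterS inBad => y By; split=> //; first exact: tpos.
  by rewrite scalerA mulfV ?gt_eqF ?tpos// scale1r addrC subrK.
- have : (fun y => `|y - x|) @ G --> `|x - x|.
    exact: (cvg_norm (cvgB Gx (cvg_cst _))).
  by rewrite subrr normr0.
split=> //; rewrite -normr_gt0.
have nvd : (fun y => `|v y|) @ G --> `|d| by exact: cvg_norm.
have one : (fun y => `|v y|) @ G --> (1 : R).
  apply: (@near_cvg_eq _ _ _ _ (fun=> 1)); last exact: cvg_cst.
  by apply: filterS vsphere => y ->.
by rewrite (cvg_unique _ nvd one).
Qed.

Hypothesis (xfeas : feasible P x) (C2P : smooth2 P).

(** A limit direction of feasible points at which [f] does not exceed [f x] is
    critical, and the Lagrangian of an S-multiplier along it does not exceed its
    value at [x] at those points, which contradicts its positive curvature. *)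
Lemma sufficient_condition :
  (forall d : X, d != 0 -> critical_cone P x d ->
     exists lg lh lPhi, S_multiplier P x d lg lh lPhi /\
       0 < lagrangian_curv P x d lg lh lPhi) ->
  strict_local_min P x.
Proof.
move=> hS; split=> //; apply: contrapT => notmin.
have CP := smooth2_smooth1 C2P; have [[df _] [dg _] [dh _] CPhi] := CP.
have dPhi i y : differentiable (Phi i) y by have [] := CPhi i.
pose Bad := [set y : X | [/\ feasible P y, y != x & f y <= f x]].
have [||G [t [v [d [PG inBad Gx t0 [vd d0]]]]]] := @limit_direction Bad.
- by move=> y [].
- move=> nBad; apply: notmin; apply: filterS nBad => y nBy yfeas yx.
  by rewrite ltNge; apply/negP => fyx; apply: nBy.
have tpos : \forall y \near G, 0 < t y by apply: filterS inBad => y [].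
have quot k (F : X -> 'rV[R]_k) : differentiable F x ->
    (fun y => (t y)^-1 *: (F (x + t y *: v y) - F x)) @ G --> 'd F x d.
  by move=> dF; exact: (diff_quotient_cvg dF tpos t0 vd).
have near_Phi : \forall y \near G, forall i r, Phi i y \in S_ r ->
    Phi i x \in S_ r /\ 'd (Phi i) x d \in S_ r.
  have hi i : \forall y \near G, forall r, Phi i y \in S_ r ->
      Phi i x \in S_ r /\ 'd (Phi i) x d \in S_ r.
    have Phic : (fun y => Phi i y) @ G --> Phi i x.
      exact: (cvg_comp _ _ Gx (differentiable_continuous (dPhi i x))).
    have h1 : \forall y \near G, forall r, Phi i y \in S_ r -> Phi i x \in S_ r.
      exact: (Phic _ (near_subspaces P (Phi i x))).
    have h2 : \forall y \near G, forall r,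
        (t y)^-1 *: (Phi i (x + t y *: v y) - Phi i x) \in S_ r ->
        'd (Phi i) x d \in S_ r.
      exact: (quot _ _ (dPhi i x) _ (near_subspaces P ('d (Phi i) x d))).
    near=> y => r yr.
    have [_ ty yE] : [/\ Bad y, 0 < t y & y = x + t y *: v y] by near: y.
    have h1y : forall r, Phi i y \in S_ r -> Phi i x \in S_ r by near: y.
    have h2y : forall r, (t y)^-1 *: (Phi i (x + t y *: v y) - Phi i x) \in S_ r ->
        'd (Phi i) x d \in S_ r by near: y.
    have xr := h1y _ yr; split=> //; apply: h2y.
    by rewrite -yE memvZ// memvB.
  exact: (filter_forall _ hi).
have quots (F : X -> R) : differentiable F x ->
    (fun y => (t y)^-1 * (F y - F x)) @ G --> ('d F x d : R).
  move=> dF; have hq : (fun y => (t y)^-1 * (F (x + t y *: v y) - F x)) @ G -->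
      ('d F x d : R) by exact: (diff_quotient_cvg dF tpos t0 vd).
  by apply: near_cvg_eq hq; apply: filterS inBad => y [_ _ <-].
have crit : critical_cone P x d.
  split.
  - move=> i gi0; rewrite -diff_coord//.
    have [dgi _] : C1 (fun y => g y 0 i : R) by apply: C1_coord; case: CP.
    apply: (cvg_le0 (quots _ (dgi x))).
    apply: filterS inBad => y [[[gy _ _] _ _] ty _] /=.
    by rewrite gi0 subr0 pmulr_rle0// invr_gt0.
  - apply/rowP => i; rewrite mxE -diff_coord//.
    have [dhi _] : C1 (fun y => h y 0 i : R) by apply: C1_coord; case: CP.
    have zero : (fun y => (t y)^-1 * (h y 0 i - h x 0 i)) @ G --> (0 : R).
      apply: (@near_cvg_eq _ _ _ _ (fun=> 0)); last exact: cvg_cst.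
      apply: filterS inBad => y [[[_ hy _] _ _] _ _].
      by have [_ hx _] := xfeas; rewrite hy hx subrr mulr0.
    exact: (cvg_unique _ (quots _ (dhi x)) zero).
  - have [y [[[[_ _ Sy] _ _] _ _] hy]] := filter_ex (filterI inBad near_Phi).
    by move=> i; have [r yr] := Sy i; have [xr dr] := hy i r yr; exists r.
  - apply: (cvg_le0 (quots _ (df x))).
    apply: filterS inBad => y [[_ _ fy] ty _] /=.
    by rewrite pmulr_rle0 ?invr_gt0// subr_le0.
have [lg [lh [lPhi [[[lg0 lgn stat] normal] curv0]]]] := hS d d0 crit.
pose L := lagrangian P lg lh lPhi.
have CL : C2 L by exact: C2_lagrangian.
have dL w : 'd L x w = 0 :> R.
  rewrite (diff_lagrangian lh lPhi w CP lgn) (grad_dotp w (df x)) -dotpDl stat.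
  by rewrite dotpE mul0mx mxE.
have ortho i r : Phi i x \in S_ r -> 'd (Phi i) x d \in S_ r ->
    orth (S_ r) (lPhi i).
  have [_ _ cPhi _] := crit.
  exact: ((tangent_normalP (lPhi i) (cPhi i)).1 (normal i) r).
have h0 y : h y = 0 -> dotp lh (h y) = 0.
  by move=> ->; rewrite -(scale0r 0) dotpZr mul0r.
have Lx : L x = f x.
  rewrite /L /lagrangian h0; last by case: xfeas.
  rewrite addr0 [dotp lg _]big1 => [|i _]; last first.
    have [/andP[/eqP -> _]|/lgn ->] := boolP (active P x d i).
      by rewrite mulr0.
    by rewrite mul0r.
  rewrite addr0 big1 ?addr0// => i _.
  by have [_ _ cPhi _] := crit; have [r xr dr] := cPhi i; rewrite (ortho i r).
have Ly : \forall y \near G, L y <= f x.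
  apply: filterS (filterI inBad near_Phi) => y [[[[gy hy Sy] _ fy] _ _] yPhi].
  apply: le_trans fy; rewrite /L /lagrangian h0// addr0 -addrA gerDl.
  rewrite [X in _ + X]big1 ?addr0 => [|i _]; last first.
    by have [r yr] := Sy i; have [xr dr] := yPhi i r yr; rewrite (ortho i r).
  apply: sumr_le0 => i _; apply: mulr_ge0_le0 (gy i).
  by have [/lg0//|/lgn ->] := boolP (active P x d i).
have hq : (fun y => (t y * t y)^-1 *
    (L (x + t y *: v y) - L x - t y * 'd L x (v y))) @ G --> 2^-1 * curv L x d.
  exact: (second_quotient_cvg CL tpos t0 vd).
suff : 2^-1 * curv L x d <= 0.
  by apply/negP; rewrite -ltNge mulr_gt0// invr_gt0.
apply: (cvg_le0 hq).
apply: filterS (filterI inBad Ly) => y [[_ ty yE] Lyx].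
rewrite /= -yE dL mulr0 subr0 Lx pmulr_rle0 ?subr_le0//.
by rewrite invr_gt0 mulr_gt0.
Unshelve. all: by end_near. Qed.

End Sufficient.
Theorem theorem3p1 (R : realType) (n m p l q N : nat)
    (P : mpdsc R n m p l q N) (xs : 'rV[R]_n) (hP : smooth1 P) :
  (forall d : 'rV[R]_n, local_min P xs -> critical_cone P xs d ->
     (MSCQ P xs d ->
        M_stationary P xs d /\
        (smooth2 P -> exists lg lh lPhi,
           M_multiplier P xs d lg lh lPhi /\
           0 <= lagrangian_curv P xs d lg lh lPhi)) /\
     (MPDSC_LICQ P xs d ->
        S_stationary P xs d /\
        (smooth2 P -> exists lg lh lPhi,
           S_multiplier P xs d lg lh lPhi /\
           0 <= lagrangian_curv P xs d lg lh lPhi))) /\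
  (feasible P xs -> smooth2 P ->
     (forall d : 'rV[R]_n, d != 0 -> critical_cone P xs d ->
        exists lg lh lPhi,
          S_multiplier P xs d lg lh lPhi /\
          0 < lagrangian_curv P xs d lg lh lPhi) ->
     strict_local_min P xs).
Proof.
split=> [d xmin crit|xfeas C2P hS]; last exact: sufficient_condition.
split=> hyp.
  have [lg [lh [lPhi [mult curv0]]]] := mscq_M_multiplier hP xmin crit hyp.
  split=> [|C2P]; first by exists lg, lh, lPhi.
  by exists lg, lh, lPhi; split; [exact: mult | exact: curv0].
have [lg [lh [lPhi [mult curv0]]]] := licq_S_multiplier hP xmin crit hyp.
split=> [|C2P]; first by exists lg, lh, lPhi.
by exists lg, lh, lPhi; split; [exact: mult | exact: curv0].
Qed.
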